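(* Let $q\in\,]-1,1[\,\setminus\{0\}$, $\mathbb{G}=\mathrm{SU}_q(2)$, $\Gamma=\widehat{\mathrm{SU}_q(2)}$, and let $J_\varphi$ be the modular conjugation of the left Haar integral $\varphi$ of $\Gamma$. The operator $\mathcal{Q}_LJ_\varphi\mathcal{Q}_L^*$ acts on $\int^\oplus_{\mathrm{Irr}(\Gamma)}\mathrm{HS}(\mathsf{H}_\lambda)\,d\mu(\lambda)$ as follows: \[ \mathcal{Q}_LJ_\varphi\mathcal{Q}_L^*:\int^\oplus_{\mathrm{Irr}(\Gamma)}T_\lambda\,d\mu(\lambda)\mapsto\int^\oplus_{\mathrm{Irr}(\Gamma)}j_\lambda\,T_{-\mathrm{sgn}(q)\lambda}\,j_\lambda\,d\mu(\lambda), \] where $j_\lambda$ is the antilinear operator on $\mathsf{H}_\lambda=\ell^2(\mathbb{Z}_+)$ given by $j_\lambda\phi_k=\phi_k$ $(\lambda\in\mathbb{T},k\in\mathbb{Z}_+)$.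
   Context: $\mathrm{SU}_q(2)$ is Woronowicz's compact quantum group: $C(\mathrm{SU}_q(2))$ is the universal unital $C^*$-algebra generated by $\alpha,\gamma$ with $\alpha^*\alpha+\gamma^*\gamma=\mathbb{1}$, $\alpha\alpha^*+q^2\gamma\gamma^*=\mathbb{1}$, $\gamma\gamma^*=\gamma^*\gamma$, $\alpha\gamma=q\gamma\alpha$, $\alpha\gamma^*=q\gamma^*\alpha$, with comultiplication $\Delta(\alpha)=\alpha\otimes\alpha-q\gamma^*\otimes\gamma$, $\Delta(\gamma)=\gamma\otimes\alpha+\alpha^*\otimes\gamma$. $h$ is its Haar state, with GNS map $\Lambda_h$ into $L^2(\mathbb{G})$. $\Gamma=\widehat{\mathrm{SU}_q(2)}$ is its dual in the Kustermans–Vaes sense, with $\hat\Gamma=\mathbb{G}$ and $L^2(\Gamma)=L^2(\mathbb{G})$; the GNS map $\Lambda_\varphi$ of the left Haar integral $\varphi$ of $\Gamma$ takes values in the same space through $\langle\Lambda_\varphi(x)|\Lambda_h((\omega\otimes\mathrm{id})\mathrm{W}^\Gamma)\rangle=\omega(x^* )$, with $\mathrm{W}^\Gamma$ the Kac–Takesaki operator of $\Gamma$ and inner products linear on the right. Up to a Plancherel-null set, $\mathrm{Irr}(\Gamma)$ (the spectrum of $C(\mathrm{SU}_q(2))$) is identified with $\mathbb{T}$ through the representations $\psi^{2,\lambda}$ $(\lambda\in\mathbb{T})$ on $\mathsf{H}_\lambda=\ell^2(\mathbb{Z}_+)$ ($\mathbb{Z}_+=\{0,1,\dots\}$, orthonormal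 basis $(\phi_k)$): $\psi^{2,\lambda}(\alpha)\phi_k=\sqrt{1-q^{2k}}\,\phi_{k-1}$ (with $\phi_{-1}=0$), $\psi^{2,\lambda}(\gamma)\phi_k=\lambda q^k\phi_k$. The Plancherel measure $\mu$ is the normalized Lebesgue measure on $\mathbb{T}$, $D_\lambda=(1-q^2)^{-1/2}\mathrm{diag}(1,|q|^{-1},|q|^{-2},\dots)$, and $\mathcal{Q}_L:L^2(\mathbb{G})\to\int^\oplus\mathrm{HS}(\mathsf{H}_\lambda)d\mu(\lambda)$ is the unitary determined by $\mathcal{Q}_L\Lambda_h(a)=\int^\oplus\psi^{2,\lambda}(a)D_\lambda^{-1}d\mu(\lambda)$, $a\in C(\mathrm{SU}_q(2))$. All $\mathsf{H}_\lambda$ equal $\ell^2(\mathbb{Z}_+)$, so that $T_{\lambda'}$ makes sense in the fibre over $\lambda$. *)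

(* Defs.v *)
From HB Require Import structures.
From mathcomp Require Import all_boot all_order all_algebra.
From mathcomp Require Import all_classical all_reals all_analysis.
From mathcomp Require Export complex.

Set Implicit Arguments.
Unset Strict Implicit.
Unset Printing Implicit Defensive.

Import Order.TTheory GRing.Theory Num.Theory.
Import numFieldNormedType.Exports.

Local Open Scope classical_set_scope.
Local Open Scope complex_scope.
Local Open Scope ring_scope.

(* Complex Hilbert spaces; the inner product is linear on the right. *)
HB.mixin Record isHilbert (R : realType) H of CompleteNormedModule R[i] H := {
  inner : H -> H -> R[i];
  innerDr : forall x y z : H, inner x (y + z) = inner x y + inner x z;
  innerZr : forall (c : R[i]) (x y : H), inner x (c *: y) = c * inner x y;
  inner_conj : forall x y : H, inner y x = (inner x y)^*;
  inner_norm : forall x : H, inner x x = `|x| ^+ 2 }.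

#[short(type="hilbertType")]
HB.structure Definition Hilbert (R : realType) :=
  {H of isHilbert R H & CompleteNormedModule R[i] H}.

(* Unital C*-algebras.  A join of the algebra and normed module structures
   cannot be declared on top of the existing hierarchy, so the multiplication
   is part of the mixin. *)
HB.mixin Record isCStarAlgebra (R : realType) A of CompleteNormedModule R[i] A := {
  cmul : A -> A -> A;
  cone : A;
  star : A -> A;
  cmulA : associative cmul;
  cmul1l : left_id cone cmul;
  cmul1r : right_id cone cmul;
  cmulDl : left_distributive cmul +%R;
  cmulDr : right_distributive cmul +%R;
  cmulZl : forall (c : R[i]) (x y : A), cmul (c *: x) y = c *: cmul x y;
  cmulZr : forall (c : R[i]) (x y : A), cmul x (c *: y) = c *: cmul x y;
  starK : involutive star;
  starD : {morph star : x y / x + y};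
  starZ : forall (c : R[i]) (x : A), star (c *: x) = c^* *: star x;
  starM : forall x y : A, star (cmul x y) = cmul (star y) (star x);
  cstar_normM : forall x y : A, `|cmul x y| <= `|x| * `|y|;
  cstar_norm : forall x : A, `|cmul (star x) x| = `|x| ^+ 2 }.

#[short(type="cstarType")]
HB.structure Definition CStarAlgebra (R : realType) :=
  {A of isCStarAlgebra R A & CompleteNormedModule R[i] A}.

Notation "x ** y" := (cmul x y) (at level 40, left associativity) : ring_scope.

Section NormedSpaces.
Variable R : realType.

(* The norm of a normed module over R[i] is an element of R[i]. *)
Definition rnorm (V : normedModType R[i]) (x : V) : R := complex.Re `|x|.

Definition sq_summable (V : normedModType R[i]) (x : nat -> V) : Prop :=
  (\sum_(0 <= n <oo) ((rnorm (x n)) ^+ 2)%:E < +oo)%E.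

Definition bounded_linear (V W : normedModType R[i]) (T : V -> W) : Prop :=
  linear T /\ exists C : R[i], forall x, `|T x| <= C * `|x|.

Definition antilinear (V W : normedModType R[i]) (T : V -> W) : Prop :=
  forall (c : R[i]) x y, T (c *: x + y) = c^* *: T x + T y.

(* The linear span of [E] is dense. *)
Definition total (V : normedModType R[i]) (E : set V) : Prop :=
  closure [set v | exists n (c : 'I_n -> R[i]) (f : 'I_n -> V),
             (forall k, E (f k)) /\ v = \sum_k c k *: f k] = setT.

End NormedSpaces.

Section Operators.
Variables (R : realType).

Definition adjoint (H K : hilbertType R) (T : H -> K) (S : K -> H) : Prop :=
  forall x y, inner (T x) y = inner x (S y).

Definition unitary (H K : hilbertType R) (U : H -> K) (Us : K -> H) : Prop :=
  [/\ bounded_linear U, adjoint U Us, cancel U Us & cancel Us U].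

Definition antiunitary (H : hilbertType R) (J : H -> H) : Prop :=
  [/\ antilinear J, forall x, `|J x| = `|x| & forall y, exists x, J x = y].

Definition positive_op (H : hilbertType R) (T : H -> H) : Prop :=
  bounded_linear T /\ forall x, 0 <= inner x (T x).

Definition orthonormal_basis (H : hilbertType R) (e : nat -> H) : Prop :=
  (forall k l, inner (e k) (e l) = (k == l)%:R) /\ total (range e).

Definition hilbert_tensor (H1 H2 H12 : hilbertType R) (t : H1 -> H2 -> H12)
    : Prop :=
  [/\ forall x, linear (t x), forall y, linear (fun x => t x y),
      forall x x' y y',
        inner (t x y) (t x' y') = inner x x' * inner y y' &
      total [set t x y | x in setT & y in setT]].

(* Positive self-adjoint, possibly unbounded operators, given by their graph *)
Definition positive_selfadjoint (H : hilbertType R) (P : set (H * H)) : Prop :=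
  [/\ closure [set v | exists w, P (v, w)] = setT,
      (* P is equal to its adjoint *)
      forall y z, P (y, z) <->
        (forall v w, P (v, w) -> inner w y = inner v z) &
      forall v w, P (v, w) -> 0 <= inner v w].

(* [S] is the graph of a closable antilinear operator; the closure has the
   polar decomposition J P.  The antilinear partial isometry J is antiunitary
   because the Tomita operator is injective with dense range. *)
Definition polar_antiunitary (H : hilbertType R) (S : set (H * H))
    (J : H -> H) : Prop :=
  antiunitary J /\
  exists P : set (H * H), positive_selfadjoint P /\
    closure S = [set p | exists w, P (p.1, w) /\ p.2 = J w].

End Operators.

Section CStar.
Variable R : realType.

(* Contractivity of *-homomorphisms is automatic. *)
Definition star_hom (A B : cstarType R) (f : A -> B) : Prop :=
  [/\ linear f, f cone = cone, forall a b, f (a ** b) = f a ** f b,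
      forall a, f (star a) = star (f a) & forall a, `|f a| <= `|a|].

Definition star_rep (A : cstarType R) (H : hilbertType R) (pi : A -> H -> H)
    : Prop :=
  [/\ forall a, bounded_linear (pi a),
      forall (c : R[i]) a b x, pi (c *: a + b) x = c *: pi a x + pi b x,
      pi cone = id, forall a b, pi (a ** b) = pi a \o pi b &
      forall a, adjoint (pi a) (pi (star a))].

Definition faithful_rep (A : cstarType R) (H : hilbertType R)
    (pi : A -> H -> H) : Prop := star_rep pi /\ injective pi.

Definition state (A : cstarType R) (h : A -> R[i]) : Prop :=
  [/\ (forall (c : R[i]) a b, h (c *: a + b) = c * h a + h b), h cone = 1,
      forall a, 0 <= h (star a ** a) & forall a, `|h a| <= `|a|].

Definition GNS (A : cstarType R) (h : A -> R[i]) (H : hilbertType R)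
    (pi : A -> H -> H) (L : A -> H) : Prop :=
  [/\ star_rep pi, linear L, forall a b, inner (L a) (L b) = h (star a ** b),
      closure (range L) = setT & forall a b, pi a (L b) = L (a ** b)].

(* The minimal (spatial) C*-tensor product of A with itself: the completion of
   the algebraic tensor product for the operator norm on H1 (x) H2, where A is
   represented faithfully on H1 and H2. *)
Definition min_tensor (A AA : cstarType R) (t : A -> A -> AA) : Prop :=
  [/\ forall a, linear (t a), forall b, linear (fun a => t a b),
      total [set t a b | a in setT & b in setT] &
      exists (H1 H2 H12 : hilbertType R) (tH : H1 -> H2 -> H12)
             (pi1 : A -> H1 -> H1) (pi2 : A -> H2 -> H2)
             (pi12 : AA -> H12 -> H12),
        [/\ hilbert_tensor tH, faithful_rep pi1, faithful_rep pi2,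
            faithful_rep pi12 &
            forall a b x y, pi12 (t a b) (tH x y) = tH (pi1 a x) (pi2 b y)]].

End CStar.

Section SUq2.
Variables (R : realType) (q : R).

Definition SUq2_relations (B : cstarType R) (al ga : B) : Prop :=
  [/\ star al ** al + star ga ** ga = cone,
      al ** star al + (q ^+ 2)%:C *: (ga ** star ga) = cone,
      ga ** star ga = star ga ** ga,
      al ** ga = q%:C *: (ga ** al) &
      al ** star ga = q%:C *: (star ga ** al)].

Definition cstar_generated (A : cstarType R) (al ga : A) : Prop :=
  forall S : set A, closed S -> S al -> S ga -> S cone ->
    (forall (c : R[i]) a b, S a -> S b -> S (c *: a + b)) ->
    (forall a b, S a -> S b -> S (a ** b)) ->
    (forall a, S a -> S (star a)) -> S = setT.

(* (A, al, ga) is C(SU_q(2)). *)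
Definition is_CSUq2 (A : cstarType R) (al ga : A) : Prop :=
  [/\ SUq2_relations al ga, cstar_generated al ga &
      forall (B : cstarType R) (b c : B), SUq2_relations b c ->
        exists f : A -> B, [/\ star_hom f, f al = b & f ga = c]].

Definition is_SUq2_comultiplication (A AA : cstarType R) (al ga : A)
    (t : A -> A -> AA) (Delta : A -> AA) : Prop :=
  [/\ star_hom Delta,
      Delta al = t al al - q%:C *: t (star ga) ga &
      Delta ga = t ga al + t (star al) ga].

End SUq2.

Section CompactQuantumGroup.
Variables (R : realType) (A AA : cstarType R) (t : A -> A -> AA).
Variable Delta : A -> AA.

(* F = h (x) id and G = id (x) h *)
Definition haar_state (h : A -> R[i]) : Prop :=
  [/\ state h,
      exists F : AA -> A, [/\ bounded_linear F,
        forall a b, F (t a b) = h a *: b &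
        forall a, F (Delta a) = h a *: cone] &
      exists G : AA -> A, [/\ bounded_linear G,
        forall a b, G (t a b) = h b *: a &
        forall a, G (Delta a) = h a *: cone]].

Variables (H HH : hilbertType R) (tH : H -> H -> HH).

(* The Kac-Takesaki operator of the compact quantum group, determined by
   W^* (L a (x) L b) = (L (x) L) (Delta(b) (a (x) 1)). *)
Definition kac_takesaki (L : A -> H) (W : HH -> HH) : Prop :=
  exists Ws : HH -> HH, unitary W Ws /\
  exists LL : AA -> HH, [/\ bounded_linear LL,
    forall a b, LL (t a b) = tH (L a) (L b) &
    forall a b, Ws (tH (L a) (L b)) = LL (Delta b ** t a cone)].

End CompactQuantumGroup.

Section DualQuantumGroup.
Variables (R : realType) (H HH : hilbertType R) (tH : H -> H -> HH).

(* The Kac-Takesaki operator of the dual: the flip of the adjoint. *)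
Definition dual_kac_takesaki (W Wd : HH -> HH) : Prop :=
  exists Ws Flip : HH -> HH, [/\ adjoint W Ws, bounded_linear Flip,
    forall x y, Flip (tH x y) = tH y x & Wd = Flip \o Ws \o Flip].

(* A pair of square-summable sequences (xi_n), (zeta_n) stands for the normal
   functional x |-> \sum_n <xi_n, x zeta_n>; every element of the predual of a
   von Neumann algebra acting on H is of this form, and the positive ones are
   those with xi = zeta. *)
Record normal_functional := NormalFunctional {
  nf_left : nat -> H;
  nf_right : nat -> H;
  nf_left_sq : sq_summable nf_left;
  nf_right_sq : sq_summable nf_right }.

Definition nf_eval (w : normal_functional) (x : H -> H) : R[i] :=
  limn (series (fun n => inner (nf_left w n) (x (nf_right w n)) : R[i]^o)).

Definition nf_positive (w : normal_functional) : Prop :=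
  nf_left w = nf_right w.

(* y = (w (x) id) Z *)
Definition slice_left (w : normal_functional) (Z : HH -> HH) (y : H -> H)
    : Prop :=
  bounded_linear y /\ forall eta eta', inner eta (y eta') =
    limn (series (fun n =>
      inner (tH (nf_left w n) eta) (Z (tH (nf_right w n) eta')) : R[i]^o)).

(* x = (id (x) w) Z *)
Definition slice_right (w : normal_functional) (Z : HH -> HH) (x : H -> H)
    : Prop :=
  bounded_linear x /\ forall xi xi', inner xi (x xi') =
    limn (series (fun n =>
      inner (tH xi (nf_left w n)) (Z (tH xi' (nf_right w n))) : R[i]^o)).

Definition commutant (S : set (H -> H)) : set (H -> H) :=
  [set y | bounded_linear y /\ forall s, S s -> y \o s = s \o y].

(* The von Neumann algebra generated by S *)
Definition vN_generated (S : set (H -> H)) : set (H -> H) :=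
  commutant (commutant (S `|` [set s' | exists2 s, S s & adjoint s s'])).

(* In this section W is the Kac-Takesaki operator of the quantum group. *)
Variable W : HH -> HH.

Definition Linfty : set (H -> H) :=
  vN_generated [set x | exists w, slice_right w W x].

(* D = W^* (1 (x) x) W *)
Definition comult_Linfty (x : H -> H) (D : HH -> HH) : Prop :=
  exists Ws X : HH -> HH, [/\ adjoint W Ws, bounded_linear X,
    forall xi eta, X (tH xi eta) = tH xi (x eta) & D = Ws \o X \o W].

Definition Linfty_pos : set (H -> H) :=
  [set x | Linfty x /\ positive_op x].

(* Values of [phi] outside [Linfty_pos] are irrelevant. *)
Variable phi : (H -> H) -> \bar R.

Definition weight : Prop :=
  [/\ forall x, Linfty_pos x -> (0 <= phi x)%E,
      forall x y, Linfty_pos x -> Linfty_pos y ->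
        phi (fun v => x v + y v) = (phi x + phi y)%E &
      forall (r : R) x, 0 <= r -> Linfty_pos x ->
        phi (fun v => r%:C *: x v) = (r%:E * phi x)%E].

(* [Nphi x] : phi(x^* x) is finite. *)
Definition Nphi : set (H -> H) :=
  [set x | Linfty x /\
     exists2 xs, adjoint x xs & (phi (xs \o x) < +oo)%E].

Definition weight_faithful : Prop :=
  forall x, Linfty_pos x -> phi x = 0%E -> forall v, x v = 0.

Definition op_le (x y : H -> H) : Prop :=
  forall v, inner v (x v) <= inner v (y v).

Definition weight_normal : Prop :=
  forall (F : set (H -> H)) (x : H -> H),
    F `<=` Linfty_pos -> F !=set0 ->
    (forall y z, F y -> F z -> exists2 u, F u & op_le y u /\ op_le z u) ->
    Linfty_pos x -> (forall y, F y -> op_le y x) ->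
    (forall z, Linfty_pos z -> (forall y, F y -> op_le y z) -> op_le x z) ->
    phi x = ereal_sup (phi @` F).

(* N_phi is sigma-weakly dense. *)
Definition weight_semifinite : Prop :=
  forall x, Linfty x ->
  forall n (w : 'I_n -> normal_functional) (e : R), 0 < e ->
    exists2 y, Nphi y &
      forall k, `|nf_eval (w k) (fun v => x v - y v)| < e%:C.

Definition left_invariant : Prop :=
  forall w x D y, nf_positive w -> Linfty_pos x -> (phi x < +oo)%E ->
    comult_Linfty x D -> slice_left w D y ->
    phi y = ((complex.Re (nf_eval w id))%:E * phi x)%E.

Definition left_haar_integral : Prop :=
  [/\ weight, weight_faithful, weight_normal, weight_semifinite &
      left_invariant].

(* [Lphi] is a GNS map for phi (with H as the GNS space); its values outside
   N_phi are irrelevant. *)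
Definition weight_GNS (Lphi : (H -> H) -> H) : Prop :=
  [/\ forall (c : R[i]) x y, Nphi x -> Nphi y ->
        Lphi (fun v => c *: x v + y v) = c *: Lphi x + Lphi y,
      forall x xs, Nphi x -> adjoint x xs ->
        phi (xs \o x) = ((rnorm (Lphi x)) ^+ 2)%:E,
      closure (Lphi @` Nphi) = setT &
      forall a x, Linfty a -> Nphi x -> Lphi (a \o x) = a (Lphi x)].

(* <Lphi(x) | L((w (x) id) W)> = w(x^* ), where L extends to the von Neumann
   algebra of the dual by L(y) = y (L 1); [Omega] stands for L 1. *)
Definition dual_GNS_pairing (Omega : H) (Lphi : (H -> H) -> H) : Prop :=
  forall w x xs y, Nphi x -> adjoint x xs -> slice_left w W y ->
    inner (Lphi x) (y Omega) = nf_eval w xs.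

(* Graph of Lphi(x) |-> Lphi(x^* ) *)
Definition tomita_graph (Lphi : (H -> H) -> H) : set (H * H) :=
  [set p | exists x xs, [/\ Nphi x, Nphi xs, adjoint x xs &
             p = (Lphi x, Lphi xs)]].

Definition modular_conjugation (Lphi : (H -> H) -> H) (J : H -> H) : Prop :=
  polar_antiunitary (tomita_graph Lphi) J.

End DualQuantumGroup.

Section Representations.
Variables (R : realType) (q : R).

Definition torus : set R[i] := [set l | `|l| = 1].

(* t in [0, 1] |-> exp(2 pi i t); normalized Lebesgue measure on the torus is
   the image of Lebesgue measure on [0, 1]. *)
Definition torus_param (t : R) : R[i] :=
  cos (2 * pi * t) +i* sin (2 * pi * t).

Variables (L : hilbertType R) (e : nat -> L).

(* [e] is the standard basis of L = l^2(Z_+). *)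
Definition psi2_rep (A : cstarType R) (al ga : A) (psi : R[i] -> A -> L -> L)
    : Prop :=
  forall l, torus l ->
    [/\ star_rep (psi l),
        forall k, psi l al (e k) =
          (Num.sqrt (1 - q ^+ (2 * k)))%:C *: (if k is k'.+1 then e k' else 0) &
        forall k, psi l ga (e k) = (l * (q ^+ k)%:C) *: e k].

Definition Plancherel_D (k : nat) : R := (Num.sqrt (1 - q ^+ 2))^-1 * `|q| ^- k.

Definition Plancherel_Dinv (Dinv : L -> L) : Prop :=
  bounded_linear Dinv /\
  forall k, Dinv (e k) = ((Plancherel_D k)^-1)%:C *: e k.

Definition hs_norm2 (T : L -> L) : \bar R :=
  (\sum_(0 <= k <oo) ((rnorm (T (e k))) ^+ 2)%:E)%E.

Definition hilbert_schmidt (T : L -> L) : Prop :=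
  bounded_linear T /\ (hs_norm2 T < +oo)%E.

Definition measurable_field (T : R[i] -> L -> L) : Prop :=
  forall k l,
    measurable_fun (`[0, 1]%classic : set R)
      (fun t : R => complex.Re (inner (e k) (T (torus_param t) (e l)))) /\
    measurable_fun (`[0, 1]%classic : set R)
      (fun t : R => complex.Im (inner (e k) (T (torus_param t) (e l)))).

Definition field_norm2 (T : R[i] -> L -> L) : \bar R :=
  (\int[lebesgue_measure]_(t in (`[0%R, 1%R]%classic : set R))
     hs_norm2 (T (torus_param t)))%E.

Definition L2_field (T : R[i] -> L -> L) : Prop :=
  [/\ forall l, torus l -> hilbert_schmidt (T l), measurable_field T &
      (field_norm2 T < +oo)%E].

Variables (K : hilbertType R) (dint : (R[i] -> L -> L) -> K).

(* [dint] is only meaningful on [L2_field]. *)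
Definition represents (T : R[i] -> L -> L) (k : K) : Prop :=
  L2_field T /\ k = dint T.

(* (K, dint) is the direct integral of HS(H_l) over the torus: the space of
   square-integrable fields modulo a.e. equality.  The norm determines the
   inner product by polarization. *)
Definition direct_integral : Prop :=
  [/\ forall (c : R[i]) S T, L2_field S -> L2_field T ->
        dint (fun l v => c *: S l v + T l v) = c *: dint S + dint T,
      forall T, L2_field T -> ((rnorm (dint T)) ^+ 2)%:E = field_norm2 T &
      forall k, exists T, represents T k].

(* [Qs] is the adjoint of [Q]. *)
Definition Plancherel_QL (A : cstarType R) (H : hilbertType R) (Lh : A -> H)
    (psi : R[i] -> A -> L -> L) (Dinv : L -> L) (Q : H -> K) (Qs : K -> H)
    : Prop :=
  unitary Q Qs /\
  forall a, represents (fun l => psi l a \o Dinv) (Q (Lh a)).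

Definition basis_conjugation (j : L -> L) : Prop :=
  [/\ antilinear j, exists C : R[i], forall x, `|j x| <= C * `|x| &
      forall k, j (e k) = e k].

End Representations.

(* Main.v *)
(* For a unitary corepresentation matrix U of SU_q(2), let r be the weights with
   S^2(U_ij) = (r_j / r_i)^2 U_ij, S being the antipode. The pairing that defines the
   GNS map of phi gives a formula for the adjoint of every x in N_phi on the vectors
   Lambda_h(U_ij). It has two consequences: the closure of the Tomita operator T = J P
   sends Lambda_h(U_ij) to Lambda_h(U_ji), and its adjoint sends Lambda_h(U_ji) to (r_j
   / r_i)^2 Lambda_h(U_ij). For the first one, the elements y^* z with y, z in N_phi
   are used, z being cut down by operators (id (x) w) W of finite rank, so that the
   graph points depend continuously on the GNS vectors of y and z. Hence, with v =
   Lambda_h(U_ij), k = r_j / r_i and w such that J w = Lambda_h(U_ji), both P v = w and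
   P w = k^2 v, so that P (w - k v) = - k (w - k v) and positivity of P forces w = k v,
   i.e. J Lambda_h(U_ij) = (r_i / r_j) Lambda_h(U_ji). This is Lambda_h of the adjoint
   of R(U_ij), R being the unitary antipode, and a |-> R(a)^* is the antilinear
   multiplicative map with alpha |-> alpha and gamma |-> - sgn(q) gamma^*, which under
   psi^{2,lambda} becomes T |-> j T j together with lambda |-> - sgn(q) lambda.
   Coefficients of the tensor powers of the fundamental corepresentation are total, and
   the flip of the circle preserves the Plancherel measure, so that the formula extends
   to all of L^2 by continuity. *)

Require Import Defs.
From mathcomp Require Import all_boot all_order all_algebra.
From mathcomp Require Import all_classical all_reals all_analysis.
From mathcomp Require Import complex.
From mathcomp Require Import measurable_realfun ring lra.

Set Implicit Arguments.
Unset Strict Implicit.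
Unset Printing Implicit Defensive.

Import Order.TTheory GRing.Theory Num.Theory.
Import numFieldNormedType.Exports.

Local Open Scope classical_set_scope.
Local Open Scope complex_scope.
Local Open Scope ring_scope.

(** * Density, closed predicates and Lipschitz maps in complex normed spaces *)

Section NormedFacts.
Variable R : realType.
Local Notation C := R[i].
Implicit Types V W X : normedModType C.

(** Norms take values in [R[i]], where [0 < e] forces [e] to be real, so this is the usual epsilon
    form of closure. *)
Lemma closure_approx V (E : set V) (x : V) :
  closure E x <-> forall e : C, 0 < e -> exists2 y, E y & `|x - y| < e.
Proof.
split=> [h e e0|h U].
  by have [y [Ey Uy]] := h _ (nbhsx_ballx x e e0); exists y; rewrite // -ball_normE in Uy.
move=> /nbhs_ballP[e /= e0 eU]; have [y Ey xy] := h e e0.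
by exists y; split=> //; apply: eU; rewrite -ball_normE.
Qed.

Lemma bounded_linearP V W (T : V -> W) : bounded_linear T ->
  exists2 M : C, 0 <= M & forall x, `|T x| <= M * `|x|.
Proof.
case=> _ [M hM]; exists `|M| => // x.
have h : 0 <= M * `|x| by apply: le_trans (hM x).
by rewrite -[`|x|]normr_id -normrM ger0_norm.
Qed.

Lemma linear_is0 V W (T : V -> W) : linear T -> T 0 = 0.
Proof. by move=> lT; have /= := lT (-1) 0 0; rewrite scaler0 addr0 scaleN1r addNr. Qed.

Lemma linear_isD V W (T : V -> W) x y : linear T -> T (x + y) = T x + T y.
Proof. by move=> lT; have /= := lT 1 x y; rewrite !scale1r. Qed.

Lemma linear_isZ V W (T : V -> W) c x : linear T -> T (c *: x) = c *: T x.
Proof. by move=> lT; have /= := lT c x 0; rewrite addr0 (linear_is0 lT) addr0. Qed.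

Lemma linear_isB V W (T : V -> W) x y : linear T -> T (x - y) = T x - T y.
Proof. by move=> lT; rewrite linear_isD// -scaleN1r linear_isZ// scaleN1r. Qed.

Lemma linear_is_sum V W (T : V -> W) (I : Type) (r : seq I) (P : pred I)
    (F : I -> V) : linear T ->
  T (\sum_(i <- r | P i) F i) = \sum_(i <- r | P i) T (F i).
Proof.
move=> lT; apply: (big_morph T) => [x y|]; [exact: linear_isD|exact: linear_is0].
Qed.

Lemma eq0_of_small V (x : V) : (forall e : C, 0 < e -> `|x| < e) -> x = 0.
Proof.
move=> h; apply/eqP; case: (eqVneq x 0) => // x0.
by have := h `|x|; rewrite normr_gt0 x0 ltxx => /(_ isT).
Qed.

(** Closedness stated by approximation, the form in which inductions over dense or total sets
    consume it. *)
Definition norm_closed V (P : V -> Prop) :=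
  forall x, (forall e : C, 0 < e -> exists2 y, P y & `|x - y| < e) -> P x.

(** Extension by linearity and continuity as an induction principle: finite combinations are reached
    by the linear step, their limits by closedness. *)
Lemma total_ind V (E : set V) (P : V -> Prop) : Defs.total E -> P 0 ->
  (forall c x y, P x -> P y -> P (c *: x + y)) -> norm_closed P ->
  (forall x, E x -> P x) -> forall x, P x.
Proof.
move=> tE P0 Pl Pc PE x; apply: Pc => e e0.
have : closure [set v | exists n (c : 'I_n -> C) (f : 'I_n -> V),
             (forall k, E (f k)) /\ v = \sum_k c k *: f k] x by rewrite tE.
move/closure_approx => /(_ e e0)[_ [n [c [f [Ef ->]]]] xe].
exists (\sum_k c k *: f k) => //.
elim/big_ind : _ => //= [a b Pa Pb|i _].
  by have := Pl 1 a b Pa Pb; rewrite scale1r.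
by have := Pl (c i) (f i) 0 (PE _ (Ef i)) P0; rewrite addr0.
Qed.

Lemma dense_ind V (E : set V) (P : V -> Prop) : closure E = setT ->
  norm_closed P -> (forall x, E x -> P x) -> forall x, P x.
Proof.
move=> dE Pc PE x; apply: Pc => e e0.
have : closure E x by rewrite dE.
by move/closure_approx => /(_ e e0)[y Ey xy]; exists y => //; apply: PE.
Qed.

(** One notion of continuity for linear, antilinear and affine maps, so that stars, conjugations and
    translations are treated alike. *)
Definition lipschitzian V W (f : V -> W) :=
  exists2 M : C, 0 <= M & forall x y, `|f x - f y| <= M * `|x - y|.

Lemma bounded_linear_lip V W (T : V -> W) : bounded_linear T -> lipschitzian T.
Proof.
move=> bT; have [M M0 hM] := bounded_linearP bT; exists M => // x y.
by rewrite -(linear_isB _ _ bT.1).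
Qed.

Lemma lipschitzian_comp V W X (f : W -> X) (g : V -> W) :
  lipschitzian f -> lipschitzian g -> lipschitzian (f \o g).
Proof.
move=> [M M0 hf] [N N0 hg]; exists (M * N); first exact: mulr_ge0.
by move=> x y; apply: le_trans (hf _ _) _; rewrite -mulrA ler_wpM2l.
Qed.

Lemma norm_closed_preim V W (f : V -> W) (P : W -> Prop) :
  lipschitzian f -> norm_closed P -> norm_closed (fun x => P (f x)).
Proof.
move=> [M M0 hf] Pc x h; apply: Pc => e e0.
(* [M] may be [0], whereas [M + 1] can be divided by. *)
have M1 : 0 < M + 1 by rewrite ltr_wpDl.
have [|y Py xy] := h (e / (M + 1)); first exact: divr_gt0.
exists (f y) => //; apply: le_lt_trans (hf _ _) _.
have : M * `|x - y| <= (M + 1) * `|x - y| by rewrite ler_wpM2r// lerDl.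
by move/le_lt_trans; apply; rewrite -ltr_pdivlMl// mulrC.
Qed.

Lemma norm_closed_eq V W (f g : V -> W) : lipschitzian f -> lipschitzian g ->
  norm_closed (fun x => f x = g x).
Proof.
move=> [M M0 hf] [N N0 hg] x h; apply/eqP; rewrite -subr_eq0; apply/eqP.
apply: eq0_of_small => e e0.
have M1 : 0 < M + N + 1 by rewrite ltr_wpDl// addr_ge0.
have [|y fg xy] := h (e / (M + N + 1)); first exact: divr_gt0.
rewrite (_ : f x - g x = (f x - f y) - (g x - g y)); last first.
  by rewrite fg opprB addrA addrNK.
apply: le_lt_trans (ler_normB _ _) _.
apply: le_lt_trans (lerD (hf _ _) (hg _ _)) _.
have : (M + N) * `|x - y| <= (M + N + 1) * `|x - y| by rewrite ler_wpM2r// lerDl.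
by rewrite -mulrDl; move/le_lt_trans; apply; rewrite -ltr_pdivlMl// mulrC.
Qed.

Lemma norm_closed_forall V (I : Type) (P : I -> V -> Prop) :
  (forall i, norm_closed (P i)) -> norm_closed (fun x => forall i, P i x).
Proof. by move=> cP x h i; apply: cP => e /h[y Py xy]; exists y. Qed.

Lemma total_ext V W (E : set V) (f g : V -> W) : Defs.total E ->
  bounded_linear f -> bounded_linear g -> (forall x, E x -> f x = g x) -> f = g.
Proof.
move=> tE bf bg fg; apply/funext; apply: (total_ind tE) => //.
- by rewrite !linear_is0//; [exact: bg.1|exact: bf.1].
- by move=> c x y fx fy; rewrite bf.1 bg.1 fx fy.
- by apply: norm_closed_eq; apply: bounded_linear_lip.
Qed.

Lemma bounded_linear_comp V W X (f : W -> X) (g : V -> W) :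
  bounded_linear f -> bounded_linear g -> bounded_linear (f \o g).
Proof.
move=> bf bg; split; first by move=> c x y /=; rewrite bg.1 bf.1.
have [M M0 hM] := bounded_linearP bf; have [N N0 hN] := bounded_linearP bg.
by exists (M * N) => x; apply: le_trans (hM _) _; rewrite -mulrA ler_wpM2l.
Qed.

Lemma bounded_linear_lincomb V W (f g : V -> W) c :
  bounded_linear f -> bounded_linear g ->
  bounded_linear (fun x => c *: f x + g x).
Proof.
move=> bf bg; split.
  by move=> d x y /=; rewrite bg.1 bf.1 !scalerDr !scalerA mulrC addrACA.
have [M M0 hM] := bounded_linearP bf; have [N N0 hN] := bounded_linearP bg.
exists (`|c| * M + N) => x; apply: le_trans (ler_normD _ _) _.
by rewrite mulrDl lerD// normrZ -mulrA ler_wpM2l.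
Qed.

Lemma bounded_linear0 V W : bounded_linear (fun _ : V => 0 : W).
Proof.
by split=> [c x y|]; [rewrite scaler0 addr0|exists 0 => x; rewrite normr0 mul0r].
Qed.

Lemma bounded_linear_sum V W (I : Type) (r : seq I) (f : I -> V -> W) :
  (forall i, bounded_linear (f i)) ->
  bounded_linear (fun x => \sum_(i <- r) f i x).
Proof.
move=> bf; elim: r => [|i r ih].
  rewrite (_ : (fun _ => _) = fun=> 0); first exact: bounded_linear0.
  by apply/funext => x; rewrite big_nil.
rewrite (_ : (fun _ => _) = fun x => 1 *: f i x + \sum_(i <- r) f i x).
  exact: bounded_linear_lincomb.
by apply/funext => x; rewrite big_cons scale1r.
Qed.

Lemma norm_closed_closure V (E : set V) : norm_closed (closure E).
Proof.
move=> x h; apply/closure_approx => e e0.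
have e2 : 0 < e / 2 by rewrite divr_gt0.
have [y /closure_approx/(_ _ e2)[z Ez yz] xy] := h _ e2; exists z => //.
rewrite (splitr e) -(subrK y x) -addrA; apply: le_lt_trans (ler_normD _ _) _.
exact: ltrD.
Qed.

Lemma lipschitzian_sum V W (I : finType) (f : I -> V -> W) :
  (forall i, lipschitzian (f i)) -> lipschitzian (fun x => \sum_i f i x).
Proof.
move=> lf; have [M hM] := choice (fun i => let: ex_intro2 m a b := lf i in ex_intro
  (fun m => 0 <= m /\ forall x y, `|f i x - f i y| <= m * `|x - y|) m (conj a b)).
exists (\sum_i M i); first by apply: sumr_ge0 => i _; case: (hM i).
move=> x y; rewrite -sumrB; apply: le_trans (ler_norm_sum _ _ _) _.
by rewrite mulr_suml; apply: ler_sum => i _; case: (hM i).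
Qed.

Lemma lipschitzian_pair V W X (f : V -> W) (g : V -> X) :
  lipschitzian f -> lipschitzian g ->
  lipschitzian (fun v => (f v, g v) : (W * X)%type).
Proof.
move=> [M M0 hM] [K K0 hK]; exists (M + K); first exact: addr_ge0.
move=> x y; rewrite prod_normE /= /Num.max; rewrite mulrDl.
case: ifP => _; [apply: le_trans (hK x y) _|apply: le_trans (hM x y) _];
  by rewrite ?lerDl ?lerDr mulr_ge0.
Qed.

Lemma lipschitzian_scalel V W (c : V -> C^o) (w : W) :
  lipschitzian c -> lipschitzian (fun v => c v *: w).
Proof.
move=> [M M0 hM]; exists (M * `|w|); first exact: mulr_ge0.
by move=> x y; rewrite -scalerBl normrZ mulrAC ler_wpM2r.
Qed.

Lemma lipschitzian_mulr V (c : V -> C^o) (d : C) :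
  lipschitzian c -> lipschitzian (fun v => c v * d : C^o).
Proof.
move=> [M M0 hM]; exists (M * `|d|); first exact: mulr_ge0.
by move=> x y; rewrite -mulrBl normrM mulrAC ler_wpM2r.
Qed.

Lemma lipschitzian_mull V (c : V -> C^o) (d : C) :
  lipschitzian c -> lipschitzian (fun v => d * c v : C^o).
Proof.
move=> [M M0 hM]; exists (`|d| * M); first exact: mulr_ge0.
by move=> x y; rewrite -mulrBr normrM -mulrA ler_wpM2l.
Qed.

Lemma rnorm_ge0 V (x : V) : 0 <= rnorm x.
Proof. by rewrite /rnorm; have := normr_ge0 x; rewrite lecE => /andP[]. Qed.

Lemma rnormE V (x : V) : (rnorm x)%:C = `|x|.
Proof.
by rewrite /rnorm; have /ger0_Im h := normr_ge0 x; rewrite [RHS]complexE h mulr0 addr0.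
Qed.

Lemma rnorm_eq V W (x : V) (y : W) : `|x| = `|y| -> rnorm x = rnorm y.
Proof. by rewrite /rnorm => ->. Qed.

End NormedFacts.

(** * Hilbert spaces: inner products, adjoints, antilinear isometries *)

Section HilbertFacts.
Variable R : realType.
Local Notation C := R[i].
Implicit Types H K L : hilbertType R.

Lemma inner0r H (x : H) : inner x 0 = 0.
Proof. by rewrite -(scale0r (0 : H)) innerZr mul0r. Qed.

Lemma inner0l H (x : H) : inner 0 x = 0.
Proof. by rewrite inner_conj inner0r rmorph0. Qed.

Lemma innerNr H (x y : H) : inner x (- y) = - inner x y.
Proof. by rewrite -scaleN1r innerZr mulN1r. Qed.

Lemma innerBr H (x y z : H) : inner x (y - z) = inner x y - inner x z.
Proof. by rewrite innerDr innerNr. Qed.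

Lemma innerDl H (x y z : H) : inner (x + y) z = inner x z + inner y z.
Proof. by rewrite inner_conj innerDr rmorphD /= -!inner_conj. Qed.

Lemma innerZl H c (x y : H) : inner (c *: x) y = c^* * inner x y.
Proof. by rewrite inner_conj innerZr rmorphM /= -!inner_conj. Qed.

Lemma innerNl H (x y : H) : inner (- x) y = - inner x y.
Proof. by rewrite inner_conj innerNr rmorphN /= -!inner_conj. Qed.

Lemma innerBl H (x y z : H) : inner (x - y) z = inner x z - inner y z.
Proof. by rewrite innerDl innerNl. Qed.

Lemma inner_sumr H (I : Type) (r : seq I) (P : pred I) (F : I -> H) x :
  inner x (\sum_(i <- r | P i) F i) = \sum_(i <- r | P i) inner x (F i).
Proof. apply: (big_morph (inner x)) => [y z|]; [exact: innerDr|exact: inner0r]. Qed.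

Lemma inner_suml H (I : Type) (r : seq I) (P : pred I) (F : I -> H) x :
  inner (\sum_(i <- r | P i) F i) x = \sum_(i <- r | P i) inner (F i) x.
Proof.
apply: (big_morph (fun y : H => inner y x)) => [y z|]; [exact: innerDl|exact: inner0l].
Qed.

(** Expand the squared norm of [y] minus its projection onto [x]; it equals
    [|y|^2 - |<x, y>|^2 / |x|^2]. *)
Lemma inner_CS H (x y : H) : `|inner x y| <= `|x| * `|y|.
Proof.
have [->|x0] := eqVneq x 0; first by rewrite inner0l !normr0 mul0r.
have nx : `|x| ^+ 2 != 0 by rewrite expf_neq0// normr_eq0.
have nr : (`|x| ^+ 2)^* = `|x| ^+ 2 by rewrite geC0_conj ?exprn_ge0.
have : 0 <= `|y - (inner x y / `|x| ^+ 2) *: x| ^+ 2 by rewrite exprn_ge0.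
rewrite -inner_norm innerBr !innerBl !innerZr !innerZl !inner_norm.
rewrite rmorphM fmorphV /= nr -(inner_conj x y).
rewrite (_ : _ - _ = `|y| ^+ 2 - `|inner x y| ^+ 2 / `|x| ^+ 2); last first.
  rewrite normCK -(inner_conj x y).
  set a := inner x y; set b := inner y x; set n := `|x| ^+ 2 in nx *.
  by field.
rewrite subr_ge0 ler_pdivrMr; last by rewrite exprn_gt0// normr_gt0.
rewrite -exprMn ler_sqr ?nnegrE ?mulr_ge0//; by rewrite mulrC.
Qed.

Lemma inner_eqr H (y z : H) : (forall x, inner x y = inner x z) -> y = z.
Proof.
move=> h; apply/eqP; rewrite -subr_eq0 -normr_eq0 -sqrf_eq0 -inner_norm.
by rewrite innerBr h subrr.
Qed.

Lemma lipschitzian_innerr H (x : H) :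
  lipschitzian (fun y => inner x y : C^o).
Proof. by exists `|x| => // y z; rewrite -innerBr inner_CS. Qed.

Lemma lipschitzian_innerl H (x : H) :
  lipschitzian (fun y => inner y x : C^o).
Proof. by exists `|x| => // y z; rewrite -innerBl mulrC inner_CS. Qed.

Lemma total_inner_eq H (E : set H) (y z : H) : Defs.total E ->
  (forall x, E x -> inner x y = inner x z) -> y = z.
Proof.
move=> tE h; apply: inner_eqr; apply: (total_ind tE) => //.
- by rewrite !inner0l.
- by move=> c a b ha hb; rewrite !innerDl !innerZl ha hb.
- exact: (@norm_closed_eq R H C^o _ _ (lipschitzian_innerl y) (lipschitzian_innerl z)).
Qed.

Lemma adjoint_sym H K (T : H -> K) S : adjoint T S -> adjoint S T.
Proof. by move=> a x y; rewrite inner_conj -a -inner_conj. Qed.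

Lemma adjoint_uniq H K (T : H -> K) S S' : adjoint T S -> adjoint T S' -> S = S'.
Proof.
by move=> a a'; apply/funext => y; apply: inner_eqr => x; rewrite -a -a'.
Qed.

Lemma adjoint_comp H K L (T : H -> K) S (T' : K -> L) S' :
  adjoint T S -> adjoint T' S' -> adjoint (T' \o T) (S \o S').
Proof. by move=> a a' x y /=; rewrite a' a. Qed.

Lemma adjoint_linear H K (T : H -> K) S : adjoint T S -> linear S.
Proof.
move=> a c x y; apply: inner_eqr => z.
by rewrite -a !innerDr !innerZr -!a.
Qed.

(** By Cauchy-Schwarz [|S y|^2 = <T (S y), y>] is at most [M |S y| |y|]; divide by [|S y|]. *)
Lemma adjoint_bounded H K (T : H -> K) S :
  adjoint T S -> bounded_linear T -> bounded_linear S.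
Proof.
move=> a bT; split; first exact: adjoint_linear a.
have [M M0 hM] := bounded_linearP bT; exists M => y.
have [->|Sy0] := eqVneq (S y) 0; first by rewrite normr0 mulr_ge0.
rewrite -(ler_pM2l (x := `|S y|)) ?normr_gt0// -expr2 -inner_norm -a.
have : `|inner (T (S y)) y| <= M * `|S y| * `|y|.
  by apply: le_trans (inner_CS _ _) _; rewrite ler_wpM2r.
by rewrite a inner_norm ger0_norm ?exprn_ge0// mulrCA mulrA.
Qed.

Lemma adjoint_sum H K (I : Type) (r : seq I) (T : I -> H -> K) S :
  (forall i, adjoint (T i) (S i)) ->
  adjoint (fun x => \sum_(i <- r) T i x) (fun y => \sum_(i <- r) S i y).
Proof.
by move=> a x y; rewrite inner_suml inner_sumr; apply: eq_bigr => i _; rewrite a.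
Qed.

Definition ketbra H (a b x : H) : H := inner b x *: a.

Lemma bounded_linear_ketbra H (a b : H) : bounded_linear (ketbra a b).
Proof.
split; first by move=> c x y; rewrite /ketbra innerDr innerZr scalerDl scalerA.
exists (`|a| * `|b|) => x; rewrite normrZ mulrC -mulrA ler_wpM2l//.
exact: inner_CS.
Qed.

Lemma adjoint_ketbra H (a b : H) : adjoint (ketbra a b) (ketbra b a).
Proof.
by move=> x y; rewrite innerZl innerZr -inner_conj mulrC.
Qed.

Lemma antilinear0 H K (J : H -> K) : antilinear J -> J 0 = 0.
Proof. by move=> aJ; have := aJ (-1) 0 0; rewrite scaler0 addr0 rmorphN1 scaleN1r addNr. Qed.

Lemma antilinearD H K (J : H -> K) x y : antilinear J -> J (x + y) = J x + J y.
Proof. by move=> aJ; have := aJ 1 x y; rewrite rmorph1 !scale1r. Qed.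

Lemma antilinearZ H K (J : H -> K) c x : antilinear J -> J (c *: x) = c^* *: J x.
Proof. by move=> aJ; have := aJ c x 0; rewrite addr0 (antilinear0 aJ) addr0. Qed.

Lemma antilinearB H K (J : H -> K) x y : antilinear J -> J (x - y) = J x - J y.
Proof.
by move=> aJ; rewrite (antilinearD _ _ aJ) -scaleN1r (antilinearZ _ _ aJ) rmorphN1 scaleN1r.
Qed.

Lemma antilinear_lip H K (J : H -> K) : antilinear J ->
  (exists M : C, forall x, `|J x| <= M * `|x|) -> lipschitzian J.
Proof.
move=> aJ [M hM]; exists `|M| => // x y; rewrite -(antilinearB _ _ aJ).
have h : 0 <= M * `|x - y| by apply: le_trans (hM _).
by rewrite -[`|x - y|]normr_id -normrM ger0_norm.
Qed.

Lemma sqr_normD H (x y : H) :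
  `|x + y| ^+ 2 = `|x| ^+ 2 + `|y| ^+ 2 + (inner x y + inner y x).
Proof.
by rewrite -!inner_norm innerDr !innerDl; ring.
Qed.

Lemma inner_polar H (x y : H) : 2 * inner x y =
  (`|x + y| ^+ 2 - `|x| ^+ 2 - `|y| ^+ 2) -
  'i * (`|x + 'i *: y| ^+ 2 - `|x| ^+ 2 - `|y| ^+ 2).
Proof.
rewrite !sqr_normD innerZr innerZl normrZ normCi mul1r conjCi.
have i2 : ('i : C) ^+ 2 = -1 by exact: sqrCi.
set a := inner x y; set b := inner y x; set n := `|x| ^+ 2; set m := `|y| ^+ 2.
by ring: i2.
Qed.

(** Polarization expresses the inner product by norms, and [J ('i *: y) = - 'i *: J y] conjugates
    the result. *)
Lemma antilinear_isometry_inner H K (J : H -> K) : antilinear J ->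
  (forall x, `|J x| = `|x|) -> forall x y, inner (J x) (J y) = (inner x y)^*.
Proof.
move=> aJ nJ x y; rewrite -inner_conj.
have h2 : (2 : C) != 0 by rewrite pnatr_eq0.
apply: (mulfI h2); rewrite !inner_polar -(antilinearD _ _ aJ).
rewrite (_ : 'i *: J y = - J ('i *: y)); last first.
  by rewrite (antilinearZ _ _ aJ) conjCi scaleNr opprK.
rewrite -(antilinearB _ _ aJ) !nJ.
rewrite !sqr_normD !innerZr !innerZl !innerNr !innerNl.
rewrite !normrN !innerZr !innerZl !normrZ normCi !mul1r conjCi.
have i2 : ('i : C) ^+ 2 = -1 by exact: sqrCi.
set a := inner x y; set b := inner y x; set n := `|x| ^+ 2; set m := `|y| ^+ 2.
by ring: i2.
Qed.

Lemma unitary_isom H K (U : H -> K) Us : unitary U Us ->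
  forall x y, inner (U x) (U y) = inner x y.
Proof. by case=> _ aU UsK _ x y; rewrite aU UsK. Qed.

Lemma norm_sqr_eq H K (x : H) (y : K) : inner x x = inner y y -> `|x| = `|y|.
Proof.
rewrite !inner_norm => /eqP; rewrite eqrXn2// => /eqP //.
Qed.

Lemma unitary_norm H K (U : H -> K) Us : unitary U Us -> forall x, `|U x| = `|x|.
Proof. by move=> uU x; apply: norm_sqr_eq; rewrite (unitary_isom uU). Qed.

Lemma unitary_sym H K (U : H -> K) Us : unitary U Us -> unitary Us U.
Proof.
case=> bU aU UK UsK; split=> //; first exact: adjoint_bounded aU bU.
exact: adjoint_sym.
Qed.

Lemma antilinear_conj_bounded H (j : H -> H) T : antilinear j ->
  (forall x, `|j x| = `|x|) -> bounded_linear T -> bounded_linear (j \o T \o j).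
Proof.
move=> aj nj bT; split.
  by move=> c x y /=; rewrite aj bT.1 aj conjCK.
have [M M0 hM] := bounded_linearP bT; exists M => x /=; rewrite nj.
by rewrite -(nj x).
Qed.

End HilbertFacts.

(** * Linear spans, total sets and their images *)

Section LinearSpan.
Variable R : realType.
Local Notation C := R[i].
Implicit Types V W : normedModType C.

(** An inductive form of the finite combinations in [total], which allows induction on an element of
    the span. *)
Inductive lspan V (E : set V) : V -> Prop :=
| lspan_nil : lspan E 0
| lspan_cons c x v : E x -> lspan E v -> lspan E (c *: x + v).

Lemma lspan_lincomb V (E : set V) c x y :
  lspan E x -> lspan E y -> lspan E (c *: x + y).
Proof.
elim=> [|d a v Ea sv ih] sy; first by rewrite scaler0 add0r.
by rewrite scalerDr scalerA -addrA; apply: lspan_cons => //; apply: ih.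
Qed.

Lemma lspan_gen V (E : set V) x : E x -> lspan E x.
Proof.
by move=> Ex; rewrite -[x]scale1r -[_ *: _]addr0; apply: lspan_cons => //; exact: lspan_nil.
Qed.

Lemma lspan_total V (E : set V) : (forall x, closure (lspan E) x) -> Defs.total E.
Proof.
move=> h; apply/seteqP; split=> // x _; apply: closureS (h x) => {}x.
elim=> [|c a v Ea _ [n [d [f [Ef ->]]]]].
  by exists 0%N, (fun=> 0), (fun=> 0); split; [case|rewrite big_ord0].
exists n.+1, (fun i => if unlift ord0 i is Some k then d k else c),
  (fun i => if unlift ord0 i is Some k then f k else a); split.
  by move=> k; case: unliftP.
rewrite big_ord_recl unlift_none; congr (_ + _).
by apply: eq_bigr => k _; rewrite liftK.
Qed.

Lemma closure_lspan_lincomb V (E : set V) c x y :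
  closure (lspan E) x -> closure (lspan E) y -> closure (lspan E) (c *: x + y).
Proof.
move=> cx cy.
have lipD (v : V) : lipschitzian (fun u => u + v).
  by exists 1 => // u w; rewrite opprD addrACA subrr addr0 mul1r.
have lipZ (v : V) : lipschitzian (fun u => c *: u + v).
  by exists `|c| => // u w; rewrite opprD addrACA subrr addr0 -scalerBr normrZ.
apply: (norm_closed_preim (lipZ y) (@norm_closed_closure _ _ _)) => e e0.
move/closure_approx: cx => /(_ e e0)[x' sx' xx']; exists x' => //.
rewrite addrC.
apply: (norm_closed_preim (lipD _) (@norm_closed_closure _ _ _)) => e' e'0.
move/closure_approx: cy => /(_ e' e'0)[y' sy' yy']; exists y' => //.
by rewrite addrC; apply: subset_closure; apply: lspan_lincomb.
Qed.

Lemma closure_lspan_ind V (E : set V) (P : V -> Prop) : P 0 ->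
  (forall c x y, P x -> P y -> P (c *: x + y)) -> norm_closed P ->
  (forall x, E x -> P x) -> forall x, closure (lspan E) x -> P x.
Proof.
move=> P0 Pl Pc PE x /closure_approx cx; apply: Pc => e e0.
have [y sy xy] := cx e e0; exists y => //.
by elim: sy => // c a v Ea _ Pv; apply: Pl => //; apply: PE.
Qed.

Lemma total_closure_lspan V (E : set V) : Defs.total E ->
  forall x, closure (lspan E) x.
Proof.
move=> tE; apply: (total_ind tE).
- by apply: subset_closure; exact: lspan_nil.
- by move=> c x y; exact: closure_lspan_lincomb.
- exact: norm_closed_closure.
- by move=> x Ex; apply: subset_closure; exact: lspan_gen.
Qed.

Lemma total_subset V (E F : set V) : E `<=` F -> Defs.total E -> Defs.total F.
Proof.
move=> EF tE; apply: lspan_total; apply: (total_ind tE).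
- by apply: subset_closure; exact: lspan_nil.
- by move=> c x y; exact: closure_lspan_lincomb.
- exact: norm_closed_closure.
- by move=> x /EF Fx; apply: subset_closure; exact: lspan_gen.
Qed.

(** By density it suffices to treat vectors [f x]. That [f x] lies in the closed span of the image
    is a closed condition on [x], because [f] is bounded, and so it may be checked on [E]. *)
Lemma total_image V W (E : set V) (f : V -> W) : Defs.total E ->
  bounded_linear f -> closure (range f) = setT ->
  Defs.total (f @` E).
Proof.
move=> tE bf df; apply: lspan_total; apply: (dense_ind df).
  exact: norm_closed_closure.
move=> _ [x _ <-]; move: x; apply: (total_ind tE).
- by rewrite linear_is0; [apply: subset_closure; exact: lspan_nil|exact: bf.1].
- by move=> c x y hx hy; rewrite bf.1; apply: closure_lspan_lincomb.
- exact: (norm_closed_preim (bounded_linear_lip bf) (@norm_closed_closure _ _ _)).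
- by move=> x Ex; apply: subset_closure; apply: lspan_gen; exists x.
Qed.

End LinearSpan.

(** * Algebra and continuity in C*-algebras *)

Section CStarFacts.
Variable R : realType.
Local Notation C := R[i].
Implicit Types A : cstarType R.

Lemma cmul0l A (x : A) : 0 ** x = 0.
Proof. by have := cmulZl 0 0 x; rewrite !scale0r. Qed.

Lemma cmul0r A (x : A) : x ** 0 = 0.
Proof. by have := cmulZr 0 x 0; rewrite !scale0r. Qed.

Lemma cmul_suml A (I : Type) (r : seq I) (P : pred I) (F : I -> A) x :
  (\sum_(i <- r | P i) F i) ** x = \sum_(i <- r | P i) F i ** x.
Proof.
apply: (big_morph (fun y : A => y ** x)) => [y z|]; [exact: cmulDl|exact: cmul0l].
Qed.

Lemma cmul_sumr A (I : Type) (r : seq I) (P : pred I) (F : I -> A) x :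
  x ** (\sum_(i <- r | P i) F i) = \sum_(i <- r | P i) x ** F i.
Proof.
apply: (big_morph (fun y : A => x ** y)) => [y z|]; [exact: cmulDr|exact: cmul0r].
Qed.

Lemma star0 A : star (0 : A) = 0.
Proof. by have := starZ 0 (0 : A); rewrite rmorph0 !scale0r. Qed.

Lemma star_sum A (I : Type) (r : seq I) (P : pred I) (F : I -> A) :
  star (\sum_(i <- r | P i) F i) = \sum_(i <- r | P i) star (F i).
Proof. apply: (big_morph (@star R A)) => [y z|]; [exact: starD|exact: star0]. Qed.

Lemma star1 A : star (cone : A) = cone.
Proof. by rewrite -[LHS]cmul1l -{1}(starK cone) -starM cmul1l starK. Qed.

Lemma star_lincomb A c (x y : A) : star (c *: x + y) = c^* *: star x + star y.
Proof. by rewrite starD starZ. Qed.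

(** The C*-identity gives [|y|^2 <= |star y| |y|], hence one inequality; the other is its instance
    at [star x]. *)
Lemma norm_star A (x : A) : `|star x| = `|x|.
Proof.
suff h : forall y : A, `|y| <= `|star y|.
  by apply/le_anti; rewrite h andbT -{2}(starK x) h.
move=> y; have [->|y0] := eqVneq y 0; first by rewrite normr0.
rewrite -(ler_pM2r (x := `|y|)) ?normr_gt0// -expr2 -cstar_norm.
exact: cstar_normM.
Qed.

Lemma lipschitzian_star A : lipschitzian (@star R A).
Proof.
exists 1 => // x y; rewrite mul1r -norm_star starD !starK.
by rewrite -scaleN1r starZ rmorphN1 scaleN1r starK.
Qed.

Lemma bounded_linear_cmull A (a : A) : bounded_linear (cmul a).
Proof.
split; first by move=> c x y; rewrite cmulDr cmulZr.
by exists `|a| => x; exact: cstar_normM.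
Qed.

Lemma lipschitzian_cmulr A (a : A) : lipschitzian (fun x : A => x ** a).
Proof.
exists `|a| => // x y; rewrite -scaleN1r -cmulZl -cmulDl scaleN1r mulrC.
exact: cstar_normM.
Qed.

End CStarFacts.

(** * Hilbert space tensor products and minimal tensor products *)

Section Tensors.
Variable R : realType.
Local Notation C := R[i].

Section HilbertTensor.
Variables (H1 H2 H12 : hilbertType R) (tH : H1 -> H2 -> H12).
Hypothesis htH : hilbert_tensor tH.

Lemma htensor_norm x y : `|tH x y| = `|x| * `|y|.
Proof.
have [_ _ itH _] := htH.
apply/eqP; rewrite -(@eqrXn2 _ 2) ?mulr_ge0//; apply/eqP.
by rewrite exprMn -!inner_norm itH.
Qed.

Lemma htensor_ext V (f g : H12 -> V : normedModType C) : bounded_linear f ->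
  bounded_linear g -> (forall x y, f (tH x y) = g (tH x y)) -> f = g.
Proof.
move=> bf bg fg; have [_ _ _ tot] := htH.
by apply: (total_ext tot) => // _ [x _ [y _ <-]].
Qed.

Lemma htensor_inner_eq (u v : H12) :
  (forall x y, inner (tH x y) u = inner (tH x y) v) -> u = v.
Proof.
move=> uv; have [_ _ _ tot] := htH.
by apply: (total_inner_eq tot) => _ [x _ [y _ <-]].
Qed.

End HilbertTensor.

Section MinTensor.
Variables (A AA : cstarType R) (t : A -> A -> AA).
Hypothesis ht : min_tensor t.

(** The product rule is inherited from operators: in the faithful representation on the Hilbert
    tensor product both sides agree on simple tensors. *)
Lemma min_tensor_mul a b c d : t a b ** t c d = t (a ** c) (b ** d).
Proof.
have [_ _ _ [H1 [H2 [H12 [tH [pi1 [pi2 [pi12 [htH fr1 fr2 fr12 E]]]]]]]]] := ht.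
have [[b12 _ _ M12 _] inj12] := fr12.
have [[_ _ _ M1 _] _] := fr1; have [[_ _ _ M2 _] _] := fr2.
apply: inj12; apply: (htensor_ext htH) => // x y.
by rewrite M12 /= !E M1 M2.
Qed.

Lemma min_tensor_star a b : star (t a b) = t (star a) (star b).
Proof.
have [_ _ _ [H1 [H2 [H12 [tH [pi1 [pi2 [pi12 [htH fr1 fr2 fr12 E]]]]]]]]] := ht.
have [[b12 _ _ _ a12] inj12] := fr12.
have [[_ _ _ _ a1] _] := fr1; have [[_ _ _ _ a2] _] := fr2.
apply: inj12; apply: (htensor_ext htH) => // x y.
apply: (htensor_inner_eq htH) => x' y'.
have [_ _ itH _] := htH.
by rewrite -a12 !E !itH a1 a2.
Qed.

End MinTensor.
End Tensors.

Lemma conjC_realc (R : realType) (x : R) : (x%:C)^* = x%:C.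
Proof. by apply/conj_Creal/complex_realP; exists x. Qed.

(** * Unitary corepresentations and the coefficients of tensor powers *)

Section Corepresentations.
Variable R : realType.
Local Notation C := R[i].
Variables (A AA : cstarType R) (t : A -> A -> AA) (Delta : A -> AA).

(* [U] is a unitary corepresentation matrix.  The antipode S satisfies
   S (U i j) = star (U j i) and S^2 (U i j) = (r j / r i)^2 U i j; [corep_conj]
   records the latter without mentioning S. *)
Record corep (I : finType) (U : I -> I -> A) (r : I -> C) : Prop := Corep {
  corep_comult : forall i j, Delta (U i j) = \sum_k t (U i k) (U k j);
  corep_starl : forall i j,
    \sum_k star (U k i) ** U k j = (i == j)%:R *: cone;
  corep_starr : forall i j,
    \sum_k U i k ** star (U j k) = (i == j)%:R *: cone;
  corep_conj : forall i j, \sum_k (r k) ^+ 2 *: (star (U j k) ** U i k) =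
    ((i == j)%:R * (r i) ^+ 2) *: cone;
  corep_pos : forall i, 0 < r i }.

Hypotheses (ht : min_tensor t) (hD : star_hom Delta).

Definition tensor_corep (I J : finType) (U : I -> I -> A) (V : J -> J -> A)
  (p p' : I * J) : A := U p.1 p'.1 ** V p.2 p'.2.

(** The star reverses products, so adjacent factors collapse in turn: those of [U] first when the
    star stands on the left, those of [V] first when it stands on the right. *)
Lemma tensor_corepP (I J : finType) (U : I -> I -> A) (V : J -> J -> A) r s :
  corep U r -> corep V s ->
  corep (tensor_corep U V) (fun p => r p.1 * s p.2).
Proof.
move=> cU cV; have [lD D1 DM Dstar Dn] := hD.
have natZ (b c : bool) : (b%:R : C) * c%:R = (b && c)%:R by rewrite -natrM mulnb.
split=> [[i i'] [j j']|[i i'] [j j']|[i i'] [j j']|[i i'] [j j']|[i i']] /=;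
  rewrite /tensor_corep /=.
- rewrite DM (corep_comult cU) (corep_comult cV) cmul_suml.
  rewrite -(pair_bigA _ (fun k k' => t (U i k ** V i' k') (U k j ** V k' j'))) /=.
  apply: eq_bigr => k _; rewrite cmul_sumr; apply: eq_bigr => k' _.
  exact: min_tensor_mul.
- rewrite -(pair_bigA _ (fun k k' => star (U k i ** V k' i') ** (U k j ** V k' j'))) /=.
  rewrite exchange_big /=.
  under eq_bigr => k' _.
    under eq_bigr => k _ do rewrite starM -cmulA (cmulA (star (U k i))).
    rewrite -cmul_sumr -cmul_suml (corep_starl cU) cmulZl cmul1l cmulZr.
    over.
  by rewrite -scaler_sumr (corep_starl cV) scalerA natZ.
- rewrite -(pair_bigA _ (fun k k' => U i k ** V i' k' ** star (U j k ** V j' k'))) /=.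
  under eq_bigr => k _.
    under eq_bigr => k' _ do rewrite starM cmulA -(cmulA (U i k)).
    rewrite -cmul_suml -cmul_sumr (corep_starr cV) cmulZr cmul1r cmulZl.
    over.
  by rewrite -scaler_sumr (corep_starr cU) scalerA natZ andbC.
- rewrite -(pair_bigA _ (fun k k' => (r k * s k') ^+ 2 *:
    (star (U j k ** V j' k') ** (U i k ** V i' k')))) /=.
  rewrite exchange_big /=.
  under eq_bigr => k' _.
    under eq_bigr => k _ do
      rewrite starM -cmulA (cmulA (star (U j k))) exprMn mulrC -scalerA -cmulZr -cmulZl.
    rewrite -scaler_sumr -cmul_sumr -cmul_suml (corep_conj cU) cmulZl cmul1l cmulZr.
    rewrite scalerA mulrC -scalerA.
    over.
  rewrite -scaler_sumr (corep_conj cV) scalerA mulrACA natZ xpair_eqE.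
  by rewrite exprMn.
- by rewrite mulr_gt0 ?(corep_pos cU) ?(corep_pos cV).
Qed.

Lemma min_tensor1 : t cone cone = cone.
Proof.
have [_ _ _ [H1 [H2 [H12 [tH [pi1 [pi2 [pi12 [htH fr1 fr2 fr12 E]]]]]]]]] := ht.
have [[b12 _ I12 _ _] inj12] := fr12.
have [[_ _ I1 _ _] _] := fr1; have [[_ _ I2 _ _] _] := fr2.
by apply: inj12; apply: (htensor_ext htH) => // x y; rewrite E I1 I2 I12.
Qed.

Lemma unit_corep : corep (fun _ _ : unit => cone) (fun=> 1).
Proof.
have [_ D1 _ _ _] := hD.
split=> // [[] []|[] []|[] []|[] []]; rewrite (big_pred1 tt) ?star1 ?cmul1l //=;
  try by case.
- by rewrite min_tensor1.
- by rewrite scale1r.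
- by rewrite scale1r.
- by rewrite expr1n mulr1.
Qed.

Variables (q : R) (al ga : A).
Hypotheses (hq0 : q != 0) (hrel : SUq2_relations q al ga).
Hypothesis hcom : is_SUq2_comultiplication q al ga t Delta.

Definition fund (i j : bool) : A :=
  match i, j with
  | false, false => al
  | false, true => - (q%:C *: star ga)
  | true, false => ga
  | true, true => star al
  end.

(** Only the ratio of the two weights matters, and it comes from [S^2(ga) = q^2 ga], as
    [S(ga) = - q ga]. *)
Definition fund_weight (i : bool) : C := if i then (`|q|^-1)%:C else 1.

(** Entry by entry, the star relations are the defining relations of SU_q(2) and the adjoints of the
    last two of them. *)
Lemma fund_corep : corep fund fund_weight.
Proof.
have [_ Da Dg] := hcom; have [lD D1 DM Dstar Dn] := hD; have [l1 l2 _ _] := ht.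
have tNl a b : t (- a) b = - t a b.
  by rewrite -scaleN1r (linear_isZ _ _ (l2 b)) scaleN1r.
have tNr a b : t a (- b) = - t a b.
  by rewrite -scaleN1r (linear_isZ _ _ (l1 a)) scaleN1r.
have tZl c a b : t (c *: a) b = c *: t a b by rewrite (linear_isZ _ _ (l2 b)).
have tZr c a b : t a (c *: b) = c *: t a b by rewrite (linear_isZ _ _ (l1 a)).
have [r1 r2 r3 r4 r5] := hrel.
have cq := conjC_realc q.
have r4s : star ga ** star al = q%:C *: (star al ** star ga).
  by rewrite -!starM r4 starZ cq.
have r5s : ga ** star al = q%:C *: (star al ** ga).
  by rewrite -{1}(starK ga) -!starM r5 starZ cq starM starK.
have sN (B : cstarType R) (a : B) : star (- a) = - star a.
  by have := starZ (-1) a; rewrite rmorphN1 !scaleN1r.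
have mNl (a b : A) : (- a) ** b = - (a ** b) by rewrite -scaleN1r cmulZl scaleN1r.
have mNr (a b : A) : a ** (- b) = - (a ** b) by rewrite -scaleN1r cmulZr scaleN1r.
(* The weight [|q|^-1] is chosen to cancel the factor [q^2] in [corep_conj]. *)
have qq : q%:C ^+ 2 * ((`|q|^-1)%:C) ^+ 2 = 1 :> C.
  rewrite -!rmorphXn -rmorphM /= exprVn real_normK ?num_real// divff//.
  by rewrite expf_neq0.
have qq1 : ((`|q|^-1)%:C) ^+ 2 * q%:C * q%:C = 1 :> C by rewrite -mulrA mulrC -expr2.
have zero (a : A) : (0%:R : C) *: a = 0 by rewrite scale0r.
have one (a : A) : (1%:R : C) *: a = a by rewrite scale1r.
split.
- case=> [] []; rewrite big_bool /= ?tNl ?tNr ?tZl ?tZr.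
  + by rewrite Dstar Da starD sN starZ cq !(min_tensor_star ht) starK.
  + by rewrite Dg addrC.
  + rewrite -scaleN1r (linear_isZ _ _ lD) (linear_isZ _ _ lD) scaleN1r.
    rewrite Dstar Dg starD !(min_tensor_star ht) starK scalerDr opprD.
    by [].
  + by rewrite Da addrC.
- case=> [] []; rewrite big_bool /= ?zero ?one ?sN ?starZ ?starK ?cq ?mNl ?mNr ?cmulZl ?cmulZr.
  + by rewrite opprK scalerA -expr2 -rmorphXn.
  + by rewrite r4 subrr.
  + by rewrite r4s subrr.
  + by rewrite addrC.
- case=> [] []; rewrite big_bool /= ?zero ?one ?sN ?starZ ?starK ?cq ?mNl ?mNr ?cmulZl ?cmulZr.
  + by rewrite r3.
  + by rewrite r5s addNr.
  + by rewrite r5 addNr.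
  + by rewrite opprK scalerA -expr2 -rmorphXn -r3 addrC.
- case=> [] []; rewrite big_bool /= ?sN ?starZ ?starK ?cq ?mNl ?mNr ?cmulZl ?cmulZr
    ?mul0r ?scale0r ?mul1r ?expr1n ?scale1r.
  + by rewrite -r2 scalerDr scalerA rmorphXn mulrC qq scale1r r3.
  + by rewrite r5s scalerN !scalerA qq1 scale1r addNr.
  + by rewrite r5 scalerN !scalerA qq1 scale1r addNr.
  + by rewrite opprK !scalerA mulrA qq1 scale1r r3 addrC.
- by case; rewrite /fund_weight// ltcR invr_gt0 normr_gt0.
Qed.

Fixpoint word (n : nat) : finType :=
  if n is n'.+1 then (bool * word n')%type else unit.

Fixpoint word_corep n : word n -> word n -> A :=
  if n is n'.+1 then tensor_corep fund (@word_corep n') else fun _ _ => cone.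

Fixpoint word_weight n : word n -> C :=
  if n is n'.+1 then fun w => fund_weight w.1 * word_weight w.2 else fun=> 1.

Lemma word_corepP n : corep (@word_corep n) (@word_weight n).
Proof.
elim: n => [|n ih]; first exact: unit_corep.
exact: (tensor_corepP fund_corep ih).
Qed.

(** The elements that, together with their adjoints, preserve the closed span of the coefficients
    under left multiplication form a closed unital star-subalgebra containing the generators, hence
    everything. Applying them to [cone] gives the claim. *)
Lemma word_coef_total : cstar_generated al ga ->
  Defs.total [set a | exists n i j, a = @word_corep n i j].
Proof.
set E := [set a | _] => gen; apply: lspan_total.
pose S := [set a : A | forall b, closure (lspan E) b ->
  closure (lspan E) (a ** b) /\ closure (lspan E) (star a ** b)].
have E1 : E cone by exists 0%N, tt, tt.
suff ST : S = setT.
  move=> a; have : S a by rewrite ST.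
  by move/(_ cone (subset_closure (lspan_gen E1))) => [+ _]; rewrite cmul1r.
have stable (a : A) : (forall x, E x -> closure (lspan E) (a ** x)) ->
    forall b, closure (lspan E) b -> closure (lspan E) (a ** b).
  move=> aE; apply: closure_lspan_ind => //.
  - by rewrite cmul0r; apply: subset_closure; exact: lspan_nil.
  - by move=> c x y hx hy; rewrite cmulDr cmulZr; apply: closure_lspan_lincomb.
  - apply: (norm_closed_preim (bounded_linear_lip (bounded_linear_cmull a))).
    exact: norm_closed_closure.
have fundE b b' x : E x -> closure (lspan E) (fund b b' ** x).
  move=> [n [i [j ->]]]; apply: subset_closure; apply: lspan_gen.
  by exists n.+1, (b, i), (b', j).
apply: gen.
- apply/closure_id/seteqP; split; first exact: subset_closure.
  move=> a /closure_approx ca b Bb.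
  have cl := @norm_closed_closure _ _ (lspan E).
  split; [apply: (norm_closed_preim (lipschitzian_cmulr b) cl)|
    apply: (norm_closed_preim (lipschitzian_comp (lipschitzian_cmulr b)
      (@lipschitzian_star _ A)) cl)] => e e0; have [y Sy ay] := ca e e0;
    exists y => //=; by have [] := Sy b Bb.
- by move=> b Bb; split; apply: stable b Bb => x;
    [exact: (fundE false false)|exact: (fundE true true)].
- move=> b Bb; split; apply: stable b Bb => x; first exact: (fundE true false).
  (* The entry [fund false true] is [- q] times [star ga], and [q] is invertible. *)
  move=> Ex; have h := fundE false true x Ex.
  have := @closure_lspan_lincomb _ _ E (- (q%:C)^-1) _ _ h (subset_closure (lspan_nil E)).
  rewrite (_ : fund false true = (- q%:C) *: star ga); last by rewrite scaleNr.
  rewrite cmulZl addr0 scalerA mulrNN mulVf ?scale1r//.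
  by apply: contraNneq hq0 => /complexI ->.
- by move=> b Bb; rewrite star1 cmul1l.
- move=> c a b Sa Sb d Bd; rewrite star_lincomb !cmulDl !cmulZl.
  have [? ?] := Sa d Bd; have [? ?] := Sb d Bd.
  by split; apply: closure_lspan_lincomb.
- move=> a b Sa Sb d Bd; rewrite starM -!cmulA.
  by have [? ?] := Sa d Bd; have [? ?] := Sb d Bd; split;
    [have [] := Sa (b ** d)|have [] := Sb (star a ** d)].
- by move=> a Sa d Bd; rewrite starK; have [] := Sa d Bd.
Qed.

End Corepresentations.

(** * Riesz representation and existence of adjoints *)

Section Riesz.
Variable R : realType.
Local Notation C := R[i].
Variable H : hilbertType R.

Lemma cauchy_seq_limit (v : nat -> H) :
  (forall e : C, 0 < e -> exists N, forall n m, (N <= n)%N -> (N <= m)%N ->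
     `|v n - v m| < e) ->
  exists l, forall e : C, 0 < e -> exists N, forall n, (N <= n)%N -> `|l - v n| < e.
Proof.
move=> cv.
have : cauchy (v @ \oo).
  apply/cauchy_ballP => e e0; have [N hN] := cv e e0.
  exists (v @` [set n | (N <= n)%N], v @` [set n | (N <= n)%N]) => /=.
    by split; exists N => // n Nn; exists n.
  by move=> [_ _] [[n Nn <-] [k Nk <-]]; rewrite -ball_normE /=; apply: hN.
move/cauchy_cvgP => cvg_v; exists (lim (v @ \oo)) => e e0.
have [N _ hN] := cvg_v _ (nbhsx_ballx _ e e0).
by exists N => n Nn; have := hN n Nn; rewrite -ball_normE.
Qed.

Variable f : H -> C^o.
Hypothesis bf : bounded_linear f.

Let G (v : H) : C := `|v| ^+ 2 - (f v + (f v)^*).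

Let G_real v : G v \is Num.real.
Proof.
apply/CrealP; rewrite /G rmorphB rmorphD /= conjCK (addrC (f v)^*).
by rewrite geC0_conj// exprn_ge0.
Qed.

Let fD u v : f (u + v) = f u + f v. Proof. by rewrite linear_isD//; exact: bf.1. Qed.
Let fZ c u : f (c *: u) = c * f u. Proof. by rewrite linear_isZ//; exact: bf.1. Qed.

(** The parallelogram law, in which the contributions of [f] cancel; it makes minimizing sequences
    Cauchy. *)
Let G_mid v w : `|v - w| ^+ 2 = 2 * G v + 2 * G w - 4 * G (2^-1 *: (v + w)).
Proof.
rewrite /G fZ fD rmorphM /= rmorphD /= -!inner_norm innerBr !innerBl.
rewrite !innerZr !innerZl !innerDr !innerDl.
have -> : (2^-1)^* = 2^-1 :> C by rewrite geC0_conj// invr_ge0.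
by field.
Qed.

Let G_perturb v t u : G (v + t *: u) =
  G v + `|t| ^+ 2 * `|u| ^+ 2 + (t * (inner v u - f u) + (t * (inner v u - f u))^*).
Proof.
rewrite /G fD fZ !rmorphD !rmorphM /= rmorphB /= -(inner_conj v u) sqr_normD.
by rewrite innerZr innerZl normrZ exprMn; ring.
Qed.

Let G_bounded : exists K : R, forall v, (- K)%:C <= G v.
Proof.
have [M M0 hM] := bounded_linearP bf.
exists (complex.Re (M ^+ 2)) => v.
have MR : (complex.Re (M ^+ 2))%:C = M ^+ 2 by apply: RRe_real; rewrite ger0_real ?exprn_ge0.
rewrite rmorphN /= MR /G.
have fr : f v + (f v)^* \is Num.real by apply/CrealP; rewrite rmorphD /= conjCK addrC.
have h : f v + (f v)^* <= 2 * (M * `|v|).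
  apply: le_trans (real_ler_norm fr) _; apply: le_trans (ler_normD _ _) _.
  by rewrite norm_conjC -mulr2n -[_ *+ 2]mulr_natl ler_pM2l.
(* Completing the square bounds [|v|^2 - 2 M |v|] below by [- M^2]. *)
have : 0 <= (`|v| - M) ^+ 2 by rewrite real_exprn_even_ge0// realB// ger0_real.
rewrite -subr_ge0 => h2; rewrite -subr_ge0.
have -> : `|v| ^+ 2 - (f v + (f v)^*) - - M ^+ 2 =
  ((`|v| - M) ^+ 2 - 0) + (2 * (M * `|v|) - (f v + (f v)^*)) by ring.
by rewrite addr_ge0// subr_ge0.
Qed.

Let minimizing : exists m : R, (forall v, m%:C <= G v) /\
  exists v : nat -> H, forall n, G (v n) <= m%:C + n.+1%:R^-1.
Proof.
have [K hK] := G_bounded.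
pose S := [set complex.Re (G v) | v in [set: H]].
have GE v : (complex.Re (G v))%:C = G v by apply: RRe_real.
have S0 : S !=set0 by exists (complex.Re (G 0)), 0.
have Slb : has_inf S.
  by split=> //; exists (- K) => _ [v _ <-]; rewrite -lecR GE.
exists (inf S); split=> [v|].
  by rewrite -GE lecR; apply: (ge_inf Slb.2); exists v.
have h n : exists v, G v <= (inf S)%:C + n.+1%:R^-1.
  have n0 : 0 < n.+1%:R^-1 :> R by rewrite invr_gt0.
  have [_ [v _ <-] hv] := inf_adherent n0 Slb; exists v.
  rewrite -GE -(rmorph_nat (real_complex R)) -fmorphV -rmorphD lecR.
  exact: ltW.
by have [v hv] := choice h; exists v.
Qed.

Let natSinv_small (e : C) : 0 < e ->
  exists N, forall n, (N <= n)%N -> n.+1%:R^-1 < e.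
Proof.
move=> e0; have eE : (complex.Re e)%:C = e by apply: RRe_real; exact: gtr0_real.
have e'0 : 0 < complex.Re e by rewrite -ltcR eE.
have [N _ hN] := near_infty_natSinv_lt (PosNum e'0).
exists N => n Nn; rewrite -eE -(rmorph_nat (real_complex R)) -fmorphV ltcR.
exact: hN n Nn.
Qed.

(* The functional is represented by the minimizer of |v|^2 - 2 Re f(v). *)
Lemma riesz : exists v, forall u, f u = inner v u.
Proof.
have [m [mG [v hv]]] := minimizing.
have c1 n k : `|v n - v k| ^+ 2 <= 2 * n.+1%:R^-1 + 2 * k.+1%:R^-1.
  rewrite G_mid -subr_ge0.
  set z := 2^-1 *: _; set a := n.+1%:R^-1; set b := k.+1%:R^-1.
  have -> : 2 * a + 2 * b - (2 * G (v n) + 2 * G (v k) - 4 * G z) =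
    2 * (m%:C + a - G (v n)) + 2 * (m%:C + b - G (v k)) + 4 * (G z - m%:C) by ring.
  by rewrite !addr_ge0// mulr_ge0// subr_ge0.
have [v0 hv0] : exists l, forall e : C, 0 < e ->
    exists N, forall n, (N <= n)%N -> `|l - v n| < e.
  apply: cauchy_seq_limit => e e0.
  have e4 : 0 < e ^+ 2 / 4 by rewrite divr_gt0 ?exprn_gt0.
  have [N hN] := natSinv_small e4; exists N => n k Nn Nk.
  rewrite -(ltr_pXn2r (n := 2)) ?nnegrE ?(ltW e0)//.
  apply: le_lt_trans (c1 _ _) _.
  have -> : e ^+ 2 = 2 * (e ^+ 2 / 4) + 2 * (e ^+ 2 / 4) by field.
  by rewrite ltrD// ltr_pM2l// hN.
exists v0 => u; apply/esym/eqP; rewrite -subr_eq0; apply/eqP.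
(* Move from [v n] along [u] by [- s d^*] with [s = 1 / (|u|^2 + 1)]. The decrease
   [s |d|^2 (2 - s |u|^2)] is at least [s |d|^2] and cannot exceed [1 / (n + 1)]. *)
have d_small n : `|inner (v n) u - f u| ^+ 2 <= (`|u| ^+ 2 + 1) * n.+1%:R^-1.
  set d := inner (v n) u - f u.
  have u1 : 0 < `|u| ^+ 2 + 1 by rewrite ltr_wpDl// exprn_ge0.
  pose s := (`|u| ^+ 2 + 1)^-1.
  have s0 : 0 < s by rewrite invr_gt0.
  have sr : s^* = s by rewrite geC0_conj// ltW.
  have := le_trans (hv n) (lerD (mG (v n + (- (s * d^*)) *: u)) (lexx n.+1%:R^-1)).
  rewrite G_perturb -/d rmorphM rmorphN rmorphM /= conjCK sr => h.
  have {}h : s * `|d| ^+ 2 * (2 - s * `|u| ^+ 2) <= n.+1%:R^-1.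
    rewrite -subr_ge0; move: h; rewrite -subr_ge0.
    rewrite normrN normrM norm_conjC (ger0_norm (ltW s0)) exprMn.
    congr (0 <= _); rewrite !normCK; ring.
  rewrite -(ler_pM2l s0) [leRHS]mulrA [s * (_ + 1)]mulVf ?gt_eqF// mul1r.
  apply: le_trans h; rewrite -[leLHS]mulr1 ler_wpM2l ?mulr_ge0 ?exprn_ge0 ?(ltW s0)//.
  rewrite lerBrDr addrC -lerBrDr (_ : 2 - 1 = 1); last by ring.
  by rewrite mulrC ler_pdivrMr// mul1r lerDl.
apply: (@eq0_of_small _ C^o) => e e0.
have u1 : 0 < `|u| + 1 by rewrite ltr_wpDl.
have u2 : 0 < `|u| ^+ 2 + 1 by rewrite ltr_wpDl// exprn_ge0.
have e1 : 0 < e / 2 / (`|u| + 1) by rewrite !divr_gt0.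
have e2 : 0 < (e / 2) ^+ 2 / (`|u| ^+ 2 + 1) by rewrite divr_gt0 ?exprn_gt0 ?divr_gt0.
have [N1 hN1] := hv0 _ e1; have [N2 hN2] := natSinv_small e2.
pose n := maxn N1 N2.
have -> : inner v0 u - f u = inner (v0 - v n) u + (inner (v n) u - f u).
  by rewrite innerBl addrA subrK.
apply: le_lt_trans (ler_normD _ _) _; rewrite (splitr e) ltrD//.
  apply: le_lt_trans (inner_CS _ _) _.
  apply: le_lt_trans (_ : `|v0 - v n| * (`|u| + 1) < _); first by rewrite ler_wpM2l// lerDl.
  by rewrite -ltr_pdivlMr// hN1// leq_maxl.
rewrite -(ltr_pXn2r (n := 2)) ?nnegrE ?divr_ge0 ?(ltW e0)//.
by apply: le_lt_trans (d_small n) _; rewrite mulrC -ltr_pdivlMr// hN2// leq_maxr.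
Qed.

End Riesz.

(** For each [y] the functional [x |-> <y, T x>] is represented by a vector, which is the value of
    the adjoint at [y]. *)
Lemma adjoint_exists (R : realType) (H K : hilbertType R) (T : H -> K) :
  bounded_linear T -> exists S, adjoint T S.
Proof.
move=> bT.
suff /choice[S hS] : forall y, exists z, forall x, inner (T x) y = inner x z.
  by exists S.
move=> y; have [|z hz] := @riesz R H (fun x => inner y (T x) : R[i]^o).
  split; first by move=> c a b; rewrite bT.1 innerDr innerZr.
  have [M M0 hM] := bounded_linearP bT; exists (`|y| * M) => x.
  by apply: le_trans (inner_CS _ _) _; rewrite -mulrA ler_wpM2l.
by exists z => x; rewrite inner_conj hz -inner_conj.
Qed.

(** * Commutants of sets of operators *)

Section Commutants.
Variables (R : realType) (H : hilbertType R).
Local Notation C := R[i].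
Implicit Types (S : set (H -> H)) (x y : H -> H).

Lemma commutant_comp S x y : commutant S x -> commutant S y -> commutant S (x \o y).
Proof.
move=> [bx cx] [by_ cy]; split; first exact: bounded_linear_comp.
move=> s Ss; rewrite -compA (cy s Ss) [RHS]compA -(cx s Ss); exact: compA.
Qed.

Lemma commutant_lincomb S c x y : (forall s, S s -> linear s) ->
  commutant S x -> commutant S y -> commutant S (fun v => c *: x v + y v).
Proof.
move=> lS [bx cx] [by_ cy]; split; first exact: bounded_linear_lincomb.
move=> s Ss; apply/funext => v /=.
rewrite (lS s Ss) -[s (x v)]/((s \o x) v) -cx//.
by rewrite -[s (y v)]/((s \o y) v) -cy.
Qed.

(** Take adjoints in [x s' = s' x], where [s'] is the adjoint of [s] and lies again in [S]. *)
Lemma commutant_adjoint S : (forall s, S s -> bounded_linear s) ->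
  (forall s s', S s -> adjoint s s' -> S s') ->
  forall x xs, commutant S x -> adjoint x xs -> commutant S xs.
Proof.
move=> bS aS x xs [bx cx] ax; split; first exact: adjoint_bounded ax bx.
move=> s Ss; have [s' as'] := adjoint_exists (bS s Ss).
have Ss' := aS s s' Ss as'.
apply: (adjoint_uniq (T := x \o s')).
  by rewrite (cx _ Ss'); exact: adjoint_comp ax (adjoint_sym as').
exact: adjoint_comp (adjoint_sym as') ax.
Qed.

End Commutants.

(** * The weight on [Linfty], its left ideal and its Tomita graph *)

Section Weights.
Variables (R : realType) (H HH : hilbertType R) (tH : H -> H -> HH) (W : HH -> HH).
Local Notation C := R[i].
Local Notation M := (Linfty tH W).

(** The star-closed generating set inside [vN_generated]; [Linfty] is by definition its
    bicommutant. *)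
Let T := [set x | exists w, slice_right tH w W x] `|`
  [set s' | exists2 s, [set x | exists w, slice_right tH w W x] s & adjoint s s'].

Let T_bounded s : T s -> bounded_linear s.
Proof.
by case=> [[w []]//|[s' [w [bs _]]] a]; exact: adjoint_bounded a bs.
Qed.

Let T_adjoint s s' : T s -> adjoint s s' -> T s'.
Proof.
case=> [Ss a|[s0 Ss0 a0] a]; first by right; exists s.
by left; rewrite (adjoint_uniq a (adjoint_sym a0)).
Qed.

Let commutantT_bounded s : commutant T s -> bounded_linear s.
Proof. by case. Qed.

Lemma Linfty_slice w x : slice_right tH w W x -> M x.
Proof.
move=> sx; split=> [|y [_ cy]]; first by case: sx.
by apply/esym/cy; left; exists w.
Qed.

Lemma Linfty_bounded x : M x -> bounded_linear x. Proof. by case. Qed.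

Lemma Linfty_comp x y : M x -> M y -> M (x \o y).
Proof. exact: commutant_comp. Qed.

Lemma Linfty_lincomb c x y : M x -> M y -> M (fun v => c *: x v + y v).
Proof. by apply: commutant_lincomb => s [[]]. Qed.

(** [commutant_adjoint] is applied twice, from the generators to their commutant and from there to
    the bicommutant. *)
Lemma Linfty_adjoint x xs : M x -> adjoint x xs -> M xs.
Proof.
apply: commutant_adjoint => [|s s' cs]; first exact: commutantT_bounded.
  exact: (commutant_adjoint T_bounded T_adjoint cs).
Qed.

Variable phi : (H -> H) -> \bar R.
Hypothesis hphi : weight tH W phi.
Local Notation N := (Nphi tH W phi).

Lemma Linfty_pos_square x xs : M x -> adjoint x xs -> Linfty_pos tH W (xs \o x).
Proof.
move=> Mx a; have Mxs := Linfty_adjoint Mx a.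
split; first exact: Linfty_comp.
split; first exact: Linfty_bounded (Linfty_comp Mxs Mx).
by move=> v /=; rewrite -a inner_norm exprn_ge0.
Qed.

(** Additivity of [phi] on [y = x + (y - x)], both summands being positive. *)
Lemma weight_mono x y : Linfty_pos tH W x -> Linfty_pos tH W y ->
  op_le x y -> (phi x <= phi y)%E.
Proof.
move=> [Mx px] [My py] xy; have [p0 pD _] := hphi.
pose z v := (-1) *: x v + y v.
have Mz : M z by exact: Linfty_lincomb.
have Pz : Linfty_pos tH W z.
  split=> //; split; first exact: Linfty_bounded.
  by move=> v; rewrite /z innerDr innerZr mulN1r addrC subr_ge0.
have -> : y = (fun v => x v + z v).
  by apply/funext => v; rewrite /z scaleN1r addrA subrr add0r.
by rewrite pD//; rewrite leeDl// p0.
Qed.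

(* N_phi is a left ideal because x^* a^* a x <= |a|^2 x^* x. *)
Lemma Nphi_ideal a x : M a -> N x -> N (a \o x).
Proof.
move=> Ma [Mx [xs axs fx]]; have ba := Linfty_bounded Ma.
have [as_ aas] := adjoint_exists ba.
split; first exact: Linfty_comp.
exists (xs \o as_); first exact: adjoint_comp.
have [K K0 hK] := bounded_linearP ba.
have Max := Linfty_comp Ma Mx.
have P1 := Linfty_pos_square Max (adjoint_comp axs aas).
have P2 := Linfty_pos_square Mx axs.
pose k := (complex.Re K) ^+ 2.
have kE : k%:C = K ^+ 2 by rewrite rmorphXn /= RRe_real// ger0_real.
have k0 : 0 <= k by rewrite /k sqr_ge0.
have [p0 pD pZ] := hphi.
have M0 : M (fun=> 0).
  have -> : (fun=> 0) = (fun v => (-1) *: x v + x v).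
    by apply/funext => v; rewrite scaleN1r addNr.
  exact: Linfty_lincomb.
have P3 : Linfty_pos tH W (fun v => k%:C *: (xs \o x) v).
  have Mk : M (fun v => k%:C *: (xs \o x) v).
    have -> : (fun v => k%:C *: (xs \o x) v) = (fun v => k%:C *: (xs \o x) v + 0).
      by apply/funext => v; rewrite addr0.
    exact: (Linfty_lincomb _ P2.1 M0).
  split=> //; split; first exact: Linfty_bounded.
  by move=> v; rewrite innerZr mulr_ge0 ?lecR// P2.2.2.
apply: (@le_lt_trans _ _ (phi (fun v => k%:C *: (xs \o x) v))).
  apply: weight_mono => // v; rewrite innerZr /= -!axs -aas !inner_norm kE.
  by rewrite -exprMn lerXn2r ?nnegrE ?mulr_ge0.
rewrite pZ//; apply: lte_mul_pinfty => //.
Qed.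

Variable Lphi : (H -> H) -> H.
Hypothesis hL : weight_GNS tH W phi Lphi.

(** [y^* x] and [x^* y] are adjoint to each other and both lie in the left ideal [Nphi]. This yields
    graph points even when the adjoints of [x] and [y] are not known to lie in [Nphi]. *)
Lemma tomita_graph_product x xs y ys : N x -> N y -> adjoint x xs -> adjoint y ys ->
  tomita_graph tH W phi Lphi (ys (Lphi x), xs (Lphi y)).
Proof.
move=> Nx Ny ax ay; have [_ _ _ mL] := hL.
have Mxs := Linfty_adjoint Nx.1 ax; have Mys := Linfty_adjoint Ny.1 ay.
exists (ys \o x), (xs \o y); split; [exact: Nphi_ideal|exact: Nphi_ideal| |].
  exact: adjoint_comp ax (adjoint_sym ay).
by rewrite (mL _ _ Mys Nx) (mL _ _ Mxs Ny).
Qed.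

End Weights.

(** * Vector functionals and their slices *)

Lemma limn_series_single (R : realType) (z : R[i]) (u : nat -> R[i]) : u 0%N = z ->
  (forall n, u n.+1 = 0) -> limn (series u : (R[i]^o)^nat) = z.
Proof.
move=> u0 uS; apply: cvg_lim => //; apply: cvg_near_cst.
(* The partial sum with index [0] is empty, so the series is constant only from index [1] on. *)
exists 1%N => // -[|n] //= _.
by rewrite /series /= big_nat_recl// u0 big1 ?addr0.
Qed.

Section VectorFunctional.
Variables (R : realType) (H HH : hilbertType R) (tH : H -> H -> HH).
Local Notation C := R[i].

Let single (a : H) (n : nat) : H := if n is 0 then a else 0.

Let single_sq a : sq_summable (single a).
Proof.
rewrite /sq_summable (@nneseries_split _ _ 0 1) //; last first.
  by move=> k _; rewrite lee_fin sqr_ge0.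
rewrite add0n big_nat1 eseries0 ?adde0 ?ltry// => -[|n] // _ _.
by rewrite /= /rnorm normr0 /= expr0n.
Qed.

Definition vector_functional (a b : H) : normal_functional H :=
  NormalFunctional (single_sq a) (single_sq b).

Lemma nf_eval_vector a b x : linear x ->
  nf_eval (vector_functional a b) x = inner a (x b).
Proof.
by move=> lx; apply: limn_series_single => // n; rewrite /= inner0l.
Qed.

Hypothesis htH : hilbert_tensor tH.

Let tH0l x : tH 0 x = 0.
Proof. by have [_ l _ _] := htH; rewrite (linear_is0 (l x)). Qed.

Let tH0r x : tH x 0 = 0.
Proof. by have [l _ _ _] := htH; rewrite (linear_is0 (l x)). Qed.

Lemma slice_left_vector a b Z y : bounded_linear y ->
  (forall eta eta', inner eta (y eta') = inner (tH a eta) (Z (tH b eta'))) ->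
  slice_left tH (vector_functional a b) Z y.
Proof.
move=> by_ h; split=> // eta eta'; rewrite h.
by symmetry; apply: limn_series_single => // n /=; rewrite tH0l inner0l.
Qed.

Lemma slice_right_vector a b Z x : bounded_linear x ->
  (forall xi xi', inner xi (x xi') = inner (tH xi a) (Z (tH xi' b))) ->
  slice_right tH (vector_functional a b) Z x.
Proof.
move=> bx h; split=> // xi xi'; rewrite h.
by symmetry; apply: limn_series_single => // n /=; rewrite tH0r inner0l.
Qed.

End VectorFunctional.

(** * The GNS map of a state *)

Section GNSFacts.
Variables (R : realType) (A : cstarType R) (h : A -> R[i]) (H : hilbertType R).
Variables (pih : A -> H -> H) (Lh : A -> H).
Hypotheses (hs : state h) (hLh : GNS h pih Lh).

(** The map is contractive: [|L a|^2 = h(a^* a) <= |a^* a| = |a|^2]. *)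
Lemma GNS_bounded : bounded_linear Lh.
Proof.
have [_ lL iL _ _] := hLh; have [_ _ _ nh] := hs.
split=> //; exists 1 => a; rewrite mul1r.
rewrite -(ler_pXn2r (n := 2)) ?nnegrE//.
rewrite -inner_norm iL -cstar_norm.
apply: le_trans (nh _); apply: real_ler_norm.
by have [_ _ p _] := hs; rewrite ger0_real.
Qed.

Lemma state_linear : linear (h : A -> R[i]^o).
Proof. by case: hs. Qed.

Lemma state_sum (I : Type) (r : seq I) (P : pred I) (F : I -> A) :
  h (\sum_(i <- r | P i) F i) = \sum_(i <- r | P i) h (F i).
Proof. exact: (linear_is_sum r P F state_linear). Qed.

Lemma stateZ c a : h (c *: a) = c * h a.
Proof. exact: (linear_isZ c a state_linear). Qed.

End GNSFacts.

(** * Rotation of the circle by a half turn *)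

Section HalfShift.
Variable R : realType.
Local Notation mu := (@lebesgue_measure R).

Let measurable_translate (c : R) :
  measurable_fun [set: measurableTypeR R] (fun t : measurableTypeR R => t + c : measurableTypeR R).
Proof. exact: measurable_funD. Qed.

(** Uniqueness of Lebesgue measure: its image under a translation agrees with it on half-open
    intervals. *)
Lemma lebesgue_measure_translate (c : R) (A : set (measurableTypeR R)) :
  measurable A -> mu A = mu ((fun t : R => t + c) @^-1` A).
Proof.
move=> mA; pose nu := measure_function_pushforward__canonical__measure_function_Measure
  mu (measurable_translate c).
rewrite -[RHS]/(nu A); apply: lebesgue_measure_unique => // _ [[a b] _ <-] /=.
rewrite /pushforward (_ : _ @^-1` _ = `]a - c, b - c]%classic); last first.
  by apply/seteqP; split=> t /=; rewrite !in_itv /= ltrBlDr lerBrDr.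
rewrite !lebesgue_measure_itv /= !lte_fin ltrD2r.
by case: ifPn => // _; rewrite -!EFinB opprB addrA subrK.
Qed.

Lemma ge0_integral_translate (c : R) (D : set R) (F : R -> \bar R) :
  measurable (D : set (measurableTypeR R)) -> measurable_fun D F ->
  (forall t, D t -> (0 <= F t)%E) ->
  (\int[mu]_(t in (fun t : R => (t + c)%R) @^-1` D) F (t + c)%R = \int[mu]_(t in D) F t)%E.
Proof.
move=> mD mF F0.
have := ge0_integral_pushforward (measurable_translate c) mu mD mF.
move=> <-; last by move=> t; rewrite inE; exact: F0.
apply: eq_measure_integral => A mA _; symmetry.
exact: lebesgue_measure_translate.
Qed.

(** Multiplication by [-1] on the circle, in the parameter of [torus_param]; it exchanges the two
    halves of [[0, 1]] up to endpoints. *)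
Definition half_shift (t : R) : R := if t < 2^-1 then t + 2^-1 else t - 2^-1.

Lemma torus_param_half_shift t : torus_param (half_shift t) = - torus_param t.
Proof.
have h (u : R) : torus_param (u + 2^-1) = - torus_param u.
  rewrite /torus_param (_ : 2 * pi * (u + 2^-1) = 2 * pi * u + pi); last by field.
  by rewrite cosDpi sinDpi.
rewrite /half_shift; case: ifP => _; first exact: h.
by rewrite -{2}(subrK 2^-1 t) h opprK.
Qed.


Let I01 : `[0, 1]%classic = `[0, 2^-1[%classic `|` `[2^-1, 1]%classic :> set R.
Proof.
apply/seteqP; split=> t /=; rewrite !in_itv /=.
  by move=> /andP[t0 t1]; case: (ltP t 2^-1) => h; [left|right]; apply/andP.
by case=> /andP[a b]; apply/andP; split=> //; [lra|lra].
Qed.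

Let disj : [disjoint `[0, 2^-1[%classic & `[2^-1, 1]%classic : set R].
Proof.
apply/disj_setPS => t [/=]; rewrite !in_itv /= => /andP[_ a] /andP[b _].
by move: (lt_le_trans a b); rewrite ltxx.
Qed.

Let pre_left : (fun t : R => t + 2^-1) @^-1` `[2^-1, 1[%classic = `[0, 2^-1[%classic :> set R.
Proof.
apply/seteqP; split=> t /=; rewrite !in_itv /= => /andP[a b]; apply/andP; split; lra.
Qed.

Let pre_right : (fun t : R => t + - 2^-1) @^-1` `[0, 2^-1]%classic = `[2^-1, 1]%classic :> set R.
Proof.
apply/seteqP; split=> t /=; rewrite !in_itv /= => /andP[a b]; apply/andP; split; lra.
Qed.

Let sub_left : `[0, 2^-1]%classic `<=` (`[0, 1]%classic : set R).
Proof. by move=> t /=; rewrite !in_itv /= => /andP[a b]; apply/andP; split; lra. Qed.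

Let sub_right : `[2^-1, 1[%classic `<=` (`[0, 1]%classic : set R).
Proof. by move=> t /=; rewrite !in_itv /= => /andP[a b]; apply/andP; split; lra. Qed.

Lemma measurable_half_shift d (Y : measurableType d) (F : R -> Y) :
  measurable_fun (`[0, 1]%classic : set R) F ->
  measurable_fun (`[0, 1]%classic : set R) (F \o half_shift).
Proof.
move=> mF; rewrite I01; apply/measurable_funU => //; split.
  apply: (@eq_measurable_fun _ _ _ _ _ (fun t : R => F (t + 2^-1))).
    by move=> t; rewrite inE /= in_itv /= /half_shift => /andP[_ ->].
  apply: (@measurable_comp _ _ _ R R Y `[2^-1, 1[%classic F _ (fun t : R => t + 2^-1)) => //.
  - by move=> _ [t + <-]; rewrite -pre_left.
  - exact: measurable_funS mF.
  - by apply: measurable_funS (measurable_translate _).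
apply: (@eq_measurable_fun _ _ _ _ _ (fun t : R => F (t + - 2^-1))).
  by move=> t; rewrite inE /= in_itv /= /half_shift => /andP[h _]; rewrite ltNge h.
apply: (@measurable_comp _ _ _ R R Y `[0, 2^-1]%classic F _ (fun t : R => t + - 2^-1)) => //.
- by move=> _ [t + <-]; rewrite -pre_right.
- exact: measurable_funS mF.
- by apply: measurable_funS (measurable_translate _).
Qed.

Lemma ge0_integral_half_shift (F : R -> \bar R) :
  measurable_fun (`[0, 1]%classic : set R) F -> (forall t, (0 <= F t)%E) ->
  (\int[mu]_(t in (`[0%R, 1%R]%classic : set R)) F (half_shift t) =
   \int[mu]_(t in (`[0%R, 1%R]%classic : set R)) F t)%E.
Proof.
move=> mF F0.
have mFs := measurable_half_shift mF.
rewrite I01 in mF mFs *.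
have [mFl mFr] : measurable_fun (`[0, 2^-1[%classic : set R) F /\
    measurable_fun (`[2^-1, 1]%classic : set R) F by apply/measurable_funU.
have mF01 : measurable_fun (`[0, 1]%classic : set R) F by rewrite I01.
have mG1 : measurable_fun (`[2^-1, 1[%classic : set R) F.
  by apply: measurable_funS mF01.
have mG2 : measurable_fun (`[0, 2^-1]%classic : set R) F.
  by apply: measurable_funS mF01.
have left : (\int[mu]_(t in (`[0%R, 2^-1%R[%classic : set R)) F (half_shift t) =
    \int[mu]_(t in (`[2^-1%R, 1%R[%classic : set R)) F t)%E.
  rewrite -[RHS](ge0_integral_translate 2^-1)//.
  rewrite pre_left; apply: eq_integral => t.
  by rewrite inE /= in_itv /= /half_shift => /andP[_ ->].
have right : (\int[mu]_(t in (`[2^-1%R, 1%R]%classic : set R)) F (half_shift t) =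
    \int[mu]_(t in (`[0%R, 2^-1%R]%classic : set R)) F t)%E.
  rewrite -[RHS](ge0_integral_translate (- 2^-1))//.
  rewrite pre_right; apply: eq_integral => t.
  by rewrite inE /= in_itv /= /half_shift => /andP[h _]; rewrite ltNge h.
rewrite !ge0_integral_setU// left right.
(* The intervals produced by the shift differ from those of the splitting by one endpoint each,
   which has measure zero. *)
rewrite integral_itv_bndo_bndc//.
by rewrite [in RHS]integral_itv_bndo_bndc// addeC.
Qed.

End HalfShift.

(** * Parseval's identity for an orthonormal basis *)

Section OrthonormalBasis.
Variables (R : realType) (L : hilbertType R) (e : nat -> L).
Local Notation C := R[i].
Hypothesis he : orthonormal_basis e.

Let ee k l : inner (e k) (e l) = (k == l)%:R. Proof. by case: he. Qed.
Let te : Defs.total (range e). Proof. by case: he. Qed.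

Let Pr n (x : L) : L := \sum_(k < n) inner (e k) x *: e k.

Let Pr_bounded n : bounded_linear (Pr n).
Proof. by apply: bounded_linear_sum => k; exact: bounded_linear_ketbra. Qed.

Let Pr_inner n x : inner x (Pr n x) = \sum_(k < n) `|inner (e k) x| ^+ 2.
Proof.
by rewrite inner_sumr; apply: eq_bigr => k _; rewrite innerZr normCK -(inner_conj (e k) x).
Qed.

Let Pr_norm n x : inner (Pr n x) (Pr n x) = \sum_(k < n) `|inner (e k) x| ^+ 2.
Proof.
rewrite {2}/Pr inner_sumr; apply: eq_bigr => k _; rewrite innerZr inner_suml.
rewrite (bigD1 k)//= big1 ?addr0.
  by rewrite innerZl ee eqxx mulr1 normCK.
by move=> l lk; rewrite innerZl ee -[(l == k :> nat)]/(l == k) (negPf lk) mulr0.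
Qed.

Let Pr_dist n x : `|x - Pr n x| ^+ 2 = `|x| ^+ 2 - \sum_(k < n) `|inner (e k) x| ^+ 2.
Proof.
rewrite -!inner_norm innerBr !innerBl Pr_norm (inner_conj x (Pr n x)) Pr_inner.
rewrite geC0_conj; last by apply: sumr_ge0 => k _; rewrite exprn_ge0.
by rewrite subrr subr0.
Qed.

Let Pr_le n x : `|Pr n x| <= `|x|.
Proof.
rewrite -(ler_pXn2r (n := 2)) ?nnegrE// -inner_norm Pr_norm -subr_ge0 -Pr_dist.
exact: exprn_ge0.
Qed.

(** Convergence is clear on basis vectors; it passes to combinations by linearity and to limits
    because each [Pr n] is a contraction. *)
Let Pr_cvg x : forall eps : C, 0 < eps ->
  exists N, forall n, (N <= n)%N -> `|x - Pr n x| < eps.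
Proof.
move: x; apply: (total_ind te).
- by move=> eps e0; exists 0%N => n _; rewrite (linear_is0 (Pr_bounded n).1) subr0 normr0.
- move=> c x y hx hy eps e0.
  have c1 : 0 < `|c| + 1 by rewrite ltr_wpDl.
  have e1 : 0 < eps / 2 / (`|c| + 1) by rewrite !divr_gt0.
  have [N1 h1] := hx _ e1; have [N2 h2] := hy (eps / 2) (divr_gt0 e0 (ltr0Sn _ _)).
  exists (maxn N1 N2) => n; rewrite geq_max => /andP[n1 n2].
  rewrite ((Pr_bounded n).1 c x y) opprD addrACA -scalerBr.
  apply: le_lt_trans (ler_normD _ _) _; rewrite (splitr eps) ltrD ?h2// normrZ.
  apply: (@le_lt_trans _ _ ((`|c| + 1) * `|x - Pr n x|)).
    by rewrite ler_wpM2r// lerDl.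
  by rewrite mulrC -ltr_pdivlMr// h1.
- move=> x h eps e0.
  have e3 : 0 < eps / 3 by rewrite divr_gt0.
  have [y hy xy] := h _ e3; have [N hN] := hy _ e3; exists N => n Nn.
  have -> : x - Pr n x = (x - y) + (y - Pr n y) + (Pr n y - Pr n x).
    by rewrite !subrKA.
  have -> : eps = eps / 3 + eps / 3 + eps / 3 by field.
  apply: le_lt_trans (ler_normD _ _) _; rewrite ltrD//.
    by apply: le_lt_trans (ler_normD _ _) _; rewrite ltrD// hN.
  rewrite -(linear_isB _ _ (Pr_bounded n).1).
  by apply: le_lt_trans (Pr_le _ _) _; rewrite distrC.
- move=> _ [k _ <-] eps e0; exists k.+1 => n kn.
  rewrite (_ : Pr n (e k) = e k) ?subrr ?normr0// /Pr (bigD1 (Ordinal kn))//= big1.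
    by rewrite ee eqxx scale1r addr0.
  move=> l; rewrite -val_eqE /= => lk.
  by rewrite ee (negPf lk) scale0r.
Qed.

(** Real and imaginary parts are kept apart because the measurability of a field is stated with
    them. *)
Lemma parseval x : ((rnorm x) ^+ 2)%:E = (\sum_(0 <= k <oo)
  ((complex.Re (inner (e k) x)) ^+ 2 + (complex.Im (inner (e k) x)) ^+ 2)%:E)%E.
Proof.
pose a k := (complex.Re (inner (e k) x)) ^+ 2 + (complex.Im (inner (e k) x)) ^+ 2.
symmetry; apply: cvg_lim => //.
rewrite (_ : (fun n => _) = EFin \o (fun n => \sum_(k < n) a k)); last first.
  by apply/funext => n /=; rewrite big_mkord sumEFin.
apply: cvg_EFin; first by near=> n.
apply/cvgrPdist_lt => eps e0.
(* This tolerance is at most [1] and at most [eps], so its square is at most [eps]. *)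
have d0 : 0 < (eps / (1 + eps))%:C by rewrite ltcR divr_gt0// addr_gt0.
have [N hN] := Pr_cvg x d0; exists N => // n /= Nn.
have e1 : 0 < 1 + eps by rewrite addr_gt0.
have dE : ((rnorm x) ^+ 2 - \sum_(k < n) a k)%:C = `|x - Pr n x| ^+ 2.
  rewrite Pr_dist rmorphB rmorphXn /= rnormE rmorph_sum; congr (_ - _).
  by apply: eq_bigr => k _; exact: add_Re2_Im2.
have d_ge0 : 0 <= (rnorm x) ^+ 2 - \sum_(k < n) a k by rewrite -lecR dE exprn_ge0.
rewrite ger0_norm// -ltcR dE.
have := hN n Nn; rewrite -(ltr_pXn2r (n := 2)) ?nnegrE ?(ltW d0)// => h.
apply: lt_le_trans h _; rewrite -rmorphXn lecR /=.
rewrite expr2 -[leRHS]mulr1 ler_pM ?divr_ge0 ?(ltW e0) ?(ltW e1)//.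
  by rewrite ler_pdivrMr// ler_pMr// lerDl ltW.
by rewrite ler_pdivrMr// mul1r lerDr.
Unshelve. all: by end_near. Qed.

End OrthonormalBasis.

(** * Square-integrable fields and their conjugation *)

Section Fields.
Variables (R : realType) (L : hilbertType R) (e : nat -> L).
Local Notation C := R[i].
Hypothesis he : orthonormal_basis e.

Lemma hs_norm2_ge0 (T : L -> L) : (0 <= hs_norm2 e T)%E.
Proof. by apply: nneseries_ge0 => k _; rewrite lee_fin sqr_ge0. Qed.

(** Parseval's identity writes the squared Hilbert-Schmidt norm as a double series in the matrix
    coefficients, which are measurable. *)
Lemma measurable_hs_norm2 (T : R[i] -> L -> L) : measurable_field e T ->
  measurable_fun (`[0, 1]%classic : set R) (fun t => hs_norm2 e (T (torus_param t))).
Proof.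
move=> mT; rewrite /hs_norm2.
rewrite (_ : (fun _ => _) = fun t => (\sum_(0 <= k <oo) \sum_(0 <= l <oo)
    ((complex.Re (inner (e l) (T (torus_param t) (e k)))) ^+ 2 +
     (complex.Im (inner (e l) (T (torus_param t) (e k)))) ^+ 2)%:E)%E); last first.
  by apply/funext => t; apply: eq_eseriesr => k _; exact: parseval.
apply: ge0_emeasurable_sum => [k t _ _|k _].
  by apply: nneseries_ge0 => l _; rewrite lee_fin addr_ge0// sqr_ge0.
apply: ge0_emeasurable_sum => [l t _ _|l _].
  by rewrite lee_fin addr_ge0// sqr_ge0.
have [m1 m2] := mT l k.
by apply/measurable_EFinP; apply: measurable_funD; apply: measurable_funX.
Qed.

(** Termwise this is [(d a + b)^2 <= 2 d^2 a^2 + 2 b^2]. *)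
Lemma hs_norm2_lincomb c (S T : L -> L) :
  (hs_norm2 e (fun v => c *: S v + T v)%R <=
   (2 * (complex.Re `|c|) ^+ 2)%R%:E * hs_norm2 e S + 2%:E * hs_norm2 e T)%E.
Proof.
rewrite /hs_norm2 -!nneseriesZl; try by move=> k _; rewrite lee_fin sqr_ge0.
rewrite -nneseriesD; last 2 first.
- by move=> k _ _; rewrite mule_ge0// lee_fin ?sqr_ge0// mulr_ge0// sqr_ge0.
- by move=> k _ _; rewrite mule_ge0// lee_fin sqr_ge0.
apply: lee_nneseries => k _; first by rewrite lee_fin sqr_ge0.
rewrite -!EFinM -EFinD lee_fin.
set a := rnorm (S (e k)); set b := rnorm (T (e k)); set d := complex.Re `|c|.
have ab : rnorm (c *: S (e k) + T (e k)) <= d * a + b.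
  have dE : d%:C = `|c| by apply: RRe_real; rewrite ger0_real.
  rewrite -lecR rmorphD rmorphM /= dE !rnormE -normrZ; exact: ler_normD.
have n0 : 0 <= rnorm (c *: S (e k) + T (e k)) by exact: rnorm_ge0.
apply: le_trans (_ : (d * a + b) ^+ 2 <= _); first by rewrite lerXn2r ?nnegrE// (le_trans n0).
rewrite -subr_ge0 (_ : _ - _ = (d * a - b) ^+ 2) ?sqr_ge0//; ring.
Qed.

Lemma L2_field_lincomb c S T : L2_field e S -> L2_field e T ->
  L2_field e (fun l v => c *: S l v + T l v).
Proof.
move=> [hS mS nS] [hT mT nT].
have mST : measurable_field e (fun l v => c *: S l v + T l v).
  move=> k l; have [a1 a2] := mS k l; have [b1 b2] := mT k l; split.
    rewrite (_ : (fun _ => _) = fun t =>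
      complex.Re c * complex.Re (inner (e k) (S (torus_param t) (e l))) -
      complex.Im c * complex.Im (inner (e k) (S (torus_param t) (e l))) +
      complex.Re (inner (e k) (T (torus_param t) (e l)))).
      by apply: measurable_funD => //; apply: measurable_funB; apply: measurable_funM.
    apply/funext => t; rewrite innerDr innerZr.
    by case: c => ? ?; case: (inner _ _) => ? ?; case: (inner _ _) => ? ?.
  rewrite (_ : (fun _ => _) = fun t =>
    complex.Re c * complex.Im (inner (e k) (S (torus_param t) (e l))) +
    complex.Im c * complex.Re (inner (e k) (S (torus_param t) (e l))) +
    complex.Im (inner (e k) (T (torus_param t) (e l)))).
    by apply: measurable_funD => //; apply: measurable_funD; apply: measurable_funM.
  apply/funext => t; rewrite innerDr innerZr.
  by case: c => ? ?; case: (inner _ _) => ? ?; case: (inner _ _) => ? ?.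
have c0 : 0 <= 2 * (complex.Re `|c|) ^+ 2 by rewrite mulr_ge0// sqr_ge0.
split; [|exact: mST|].
  move=> l tl; have [bS fS] := hS l tl; have [bT fT] := hT l tl.
  split; first exact: bounded_linear_lincomb.
  apply: le_lt_trans (hs_norm2_lincomb _ _ _) _.
  by rewrite lte_add_pinfty// lte_mul_pinfty// lee_fin.
have mS2 := measurable_hs_norm2 mS; have mT2 := measurable_hs_norm2 mT.
have mST2 := measurable_hs_norm2 mST.
rewrite /field_norm2.
apply: (@le_lt_trans _ _ (\int[lebesgue_measure]_(t in (`[0%R, 1%R]%classic : set R))
  ((2 * (complex.Re `|c|) ^+ 2)%R%:E * hs_norm2 e (S (torus_param t)) +
   2%:E * hs_norm2 e (T (torus_param t))))%E).
  apply: ge0_le_integral => //.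
  - by move=> t _; exact: hs_norm2_ge0.
  - by apply: emeasurable_funD; apply: measurable_funeM.
  - by move=> t _; exact: hs_norm2_lincomb.
rewrite ge0_integralD//=; last 4 first.
- by move=> t _; rewrite mule_ge0 ?hs_norm2_ge0.
- exact: measurable_funeM.
- by move=> t _; rewrite mule_ge0 ?hs_norm2_ge0.
- exact: measurable_funeM.
rewrite !ge0_integralZl//; try by move=> t _; exact: hs_norm2_ge0.
by rewrite lte_add_pinfty// lte_mul_pinfty// ?lee_fin// ?ge0_integral//;
  apply: integral_ge0 => t _; exact: hs_norm2_ge0.
Qed.

Variables (K : hilbertType R) (dint : (R[i] -> L -> L) -> K).
Hypothesis hK : direct_integral e dint.

Lemma dint_dist S T : L2_field e S -> L2_field e T ->
  ((rnorm (dint S - dint T)) ^+ 2)%:E = field_norm2 e (fun l v => S l v - T l v).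
Proof.
move=> hS hT; have [dl dn _] := hK.
have -> : (fun l v => S l v - T l v) = (fun l v => (-1) *: T l v + S l v).
  by apply/funext => l; apply/funext => v; rewrite scaleN1r addrC.
rewrite -dn; last exact: L2_field_lincomb.
by rewrite (dl (-1) T S)// scaleN1r addrC.
Qed.

Lemma torus_paramP (t : R) : torus (torus_param t).
Proof.
rewrite /torus /=; apply/eqP; rewrite -(eqrXn2 (n := 2))// expr1n -add_Re2_Im2 /=.
by rewrite cos2Dsin2.
Qed.

Lemma eq_field_norm2 S T : (forall l, torus l -> S l = T l) ->
  field_norm2 e S = field_norm2 e T.
Proof.
move=> ST; rewrite /field_norm2; congr (integral _ _ _); apply/funext => t.
by rewrite ST//; exact: torus_paramP.
Qed.

(** Fields are functions on all of [R[i]], but [field_norm2] sees only the circle, so the difference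
    has norm [0]. *)
Lemma eq_dint S T : L2_field e S -> L2_field e T -> (forall l, torus l -> S l = T l) ->
  dint S = dint T.
Proof.
move=> hS hT ST; apply/eqP; rewrite -subr_eq0 -normr_eq0 -rnormE.
have := dint_dist hS hT.
rewrite (@eq_field_norm2 _ (fun _ _ => 0)); last first.
  by move=> l tl; apply/funext => v; rewrite ST// subrr.
rewrite /field_norm2 /hs_norm2.
under eq_integral => t _.
  rewrite eseries0; last by move=> k _ _; rewrite /rnorm normr0 /= expr0n.
  over.
rewrite integral0 => -[] /eqP; rewrite sqrf_eq0 => /eqP ->.
by rewrite eqxx.
Qed.

Variable j : L -> L.
Hypothesis hj : basis_conjugation e j.

Let aj : antilinear j. Proof. by case: hj. Qed.
Let je k : j (e k) = e k. Proof. by case: hj. Qed.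
Let te : Defs.total (range e). Proof. by case: he. Qed.
Let lj : lipschitzian j. Proof. by case: hj => a b _; exact: antilinear_lip. Qed.

Let lip_conj (V : normedModType C) (f : V -> C^o) :
  lipschitzian f -> lipschitzian (fun v => (f v)^* : C^o).
Proof.
move=> [M M0 hM]; exists M => // x y; rewrite -rmorphB norm_conjC; exact: hM.
Qed.

(** Both sides are continuous in each variable and transform alike under combinations, so it
    suffices to compare them on basis vectors, which [j] fixes. *)
Lemma basis_conjugation_inner x y : inner (j x) (j y) = (inner x y)^*.
Proof.
have h k z : inner (e k) (j z) = (inner (e k) z)^*.
  move: z; apply: (total_ind te).
  - by rewrite (antilinear0 aj) !inner0r rmorph0.
  - by move=> c a b ha hb; rewrite aj !innerDr !innerZr ha hb rmorphD rmorphM.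
  - apply: (@norm_closed_eq _ _ C^o).
      exact: lipschitzian_comp (lipschitzian_innerr (e k)) lj.
    exact: lip_conj (lipschitzian_innerr (e k)).
  - move=> _ [l _ <-]; have [ee _] := he.
    by rewrite je ee rmorph_nat.
move: x; apply: (total_ind te).
- by rewrite (antilinear0 aj) !inner0l rmorph0.
- by move=> c a b ha hb; rewrite aj !innerDl !innerZl ha hb rmorphD rmorphM.
- apply: (@norm_closed_eq _ _ C^o).
    exact: lipschitzian_comp (lipschitzian_innerl (j y)) lj.
  exact: lip_conj (lipschitzian_innerl y).
- by move=> _ [k _ <-]; rewrite je h.
Qed.

Lemma basis_conjugation_norm x : `|j x| = `|x|.
Proof.
by apply: norm_sqr_eq; rewrite basis_conjugation_inner inner_norm geC0_conj ?exprn_ge0.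
Qed.

Lemma basis_conjugationK x : j (j x) = x.
Proof.
apply: (total_inner_eq te) => _ [k _ <-].
by rewrite -{1}je basis_conjugation_inner -{1}je basis_conjugation_inner conjCK.
Qed.

Variable q : R.
Hypothesis hq0 : q != 0.

Definition conj_field (T : R[i] -> L -> L) (l : R[i]) : L -> L :=
  j \o T (- ((Num.sg q)%:C * l)) \o j.

Let sg_cases : (Num.sg q = 1) \/ (Num.sg q = -1).
Proof. by case: sgrP hq0 => [_|_ _|_ _]; rewrite ?eqxx //; [left|right]. Qed.

Lemma torus_flip l : torus l -> torus (- ((Num.sg q)%:C * l)).
Proof.
rewrite /torus /= normrN normrM => ->.
by case: sg_cases => ->; rewrite ?rmorphN1 ?normrN normr1 mulr1.
Qed.

(** The map [l |-> - sgn(q) l] in the circle parameter: a half turn for [q > 0], the identity for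
    [q < 0]. *)
Let flip (t : R) : R := if Num.sg q == 1 then half_shift t else t.

Let flipE t : - ((Num.sg q)%:C * torus_param t) = torus_param (flip t).
Proof.
rewrite /flip; case: sg_cases => ->.
  by rewrite eqxx mul1r torus_param_half_shift.
rewrite (lt_eqF (lt_trans (ltrN10 R) ltr01)).
by rewrite rmorphN1 mulN1r opprK.
Qed.

Let measurable_flip (F : R -> R) : measurable_fun (`[0, 1]%classic : set R) F ->
  measurable_fun (`[0, 1]%classic : set R) (fun t => F (flip t)).
Proof.
by rewrite /flip; case: (Num.sg q == 1) => //; exact: measurable_half_shift.
Qed.

Let hs_conj T : hs_norm2 e (j \o T \o j) = hs_norm2 e T.
Proof.
apply: eq_eseriesr => k _ /=; rewrite je; congr ((_ ^+ 2)%:E).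
by apply: rnorm_eq; rewrite basis_conjugation_norm.
Qed.

(** Fibrewise, [j] is isometric and fixes the basis, so the Hilbert-Schmidt norm is kept; the flip
    of the circle preserves the measure. *)
Lemma conj_field_norm2 T : measurable_field e T ->
  field_norm2 e (conj_field T) = field_norm2 e T.
Proof.
move=> mT; rewrite /field_norm2 /conj_field.
under eq_integral => t _ do rewrite hs_conj flipE.
rewrite /flip; case: (Num.sg q == 1) => //.
apply: (ge0_integral_half_shift (F := fun t => hs_norm2 e (T (torus_param t)))).
  exact: measurable_hs_norm2.
by move=> t; exact: hs_norm2_ge0.
Qed.

Lemma L2_conj_field T : L2_field e T -> L2_field e (conj_field T).
Proof.
move=> [hT mT nT]; split.
- move=> l tl; have [bT fT] := hT _ (torus_flip tl); split.
    exact: antilinear_conj_bounded aj basis_conjugation_norm bT.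
  by rewrite /conj_field hs_conj.
- move=> k l; have [m1 m2] := mT k l.
  have jE t : inner (e k) (conj_field T (torus_param t) (e l)) =
      (inner (e k) (T (torus_param (flip t)) (e l)))^*.
    by rewrite /conj_field /= flipE je -{1}(je k) basis_conjugation_inner.
  split.
    rewrite (_ : (fun _ => _) = fun t =>
      complex.Re (inner (e k) (T (torus_param (flip t)) (e l)))).
      exact: measurable_flip m1.
    by apply/funext => t; rewrite jE; case: (inner _ _).
  rewrite (_ : (fun _ => _) = fun t =>
    - complex.Im (inner (e k) (T (torus_param (flip t)) (e l)))).
    by apply: measurableT_comp => //; exact: measurable_flip m2.
  by apply/funext => t; rewrite jE; case: (inner _ _).
- by rewrite conj_field_norm2.
Qed.

(** The continuity needed to pass from a dense set of vectors in the direct integral to all of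
    them. *)
Lemma conj_field_dist S T : L2_field e S -> L2_field e T ->
  rnorm (dint (conj_field S) - dint (conj_field T)) = rnorm (dint S - dint T).
Proof.
move=> hS hT; apply/eqP; rewrite -(eqrXn2 (n := 2)) ?rnorm_ge0//; apply/eqP/EFin_inj.
rewrite dint_dist; [|exact: L2_conj_field..].
rewrite dint_dist// -(conj_field_norm2 (T := fun l v => S l v - T l v)).
  congr (field_norm2 e _); apply/funext => l; apply/funext => v.
  by rewrite /conj_field /= (antilinearB _ _ aj).
have -> : (fun l v => S l v - T l v) = (fun l v => (-1) *: T l v + S l v).
  by apply/funext => l; apply/funext => v; rewrite scaleN1r addrC.
by have [] := L2_field_lincomb (-1) hT hS.
Qed.

End Fields.

Lemma bounded_linear_inner (R : realType) (V : normedModType R[i])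
    (K : hilbertType R) (z : K) (f : V -> K) :
  bounded_linear f -> bounded_linear (fun v => inner z (f v) : R[i]^o).
Proof.
move=> bf; split; first by move=> c a b; rewrite bf.1 innerDr innerZr.
have [M M0 hM] := bounded_linearP bf; exists (`|z| * M) => v.
by apply: le_trans (inner_CS _ _) _; rewrite -mulrA ler_wpM2l.
Qed.

(** * The Tomita operator of the dual weight on matrix coefficients *)

Section DualWeight.
Variables (R : realType).
Local Notation C := R[i].
Variables (A AA : cstarType R) (t : A -> A -> AA) (Delta : A -> AA).
Hypotheses (ht : min_tensor t) (hD : star_hom Delta).
Variables (h : A -> R[i]) (hh : haar_state t Delta h).
Variables (H : hilbertType R) (pih : A -> H -> H) (Lh : A -> H).
Hypothesis hLh : GNS h pih Lh.
Variables (HH : hilbertType R) (tH : H -> H -> HH) (htH : hilbert_tensor tH).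
Variables (WG W : HH -> HH).
Hypotheses (hWG : kac_takesaki t Delta tH Lh WG) (hW : dual_kac_takesaki tH WG W).

Implicit Types I J : finType.

Let hs : state h. Proof. by case: hh. Qed.
Let lLh : linear Lh. Proof. by case: hLh. Qed.
Let iLh a b : inner (Lh a) (Lh b) = h (star a ** b). Proof. by case: hLh. Qed.

Lemma dual_kac_takesaki_bounded : bounded_linear W.
Proof.
have [Ws [uW _]] := hWG; have [Ws' [Flip [aW bF _ ->]]] := hW.
have [_ a _ _] := uW; rewrite (adjoint_uniq aW a).
have [bWs _ _ _] := unitary_sym uW.
exact: bounded_linear_comp (bounded_linear_comp bF bWs) bF.
Qed.

(** [W] is the adjoint of [WG] conjugated by the flip, and that adjoint sends [L a (x) L(U_ij)] to
    [(L (x) L)(Delta(U_ij) (a (x) 1))]. *)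
Lemma dual_kac_takesaki_corep I U r : @corep R A AA t Delta I U r ->
  forall i j a, W (tH (Lh (U i j)) (Lh a)) =
    \sum_k tH (Lh (U k j)) (Lh (U i k ** a)).
Proof.
move=> cU i j a.
have [Ws [uW [LL [bLL LLE WsE]]]] := hWG; have [Ws' [Flip [aW bF FE ->]]] := hW.
have [_ a' _ _] := uW; rewrite (adjoint_uniq aW a') /= FE WsE (corep_comult cU).
rewrite cmul_suml (linear_is_sum _ _ _ bLL.1) (linear_is_sum _ _ _ bF.1).
apply: eq_bigr => k _.
by rewrite (min_tensor_mul ht) cmul1r LLE FE.
Qed.

(* Apply h (x) id to Delta (U_ik^* V_mn) and use the invariance of h. *)
Lemma haar_invariance I U r J V s : @corep R A AA t Delta I U r ->
  @corep R A AA t Delta J V s -> forall i j m n,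
  \sum_p h (star (U i j) ** V m p) *: V p n =
  \sum_k h (star (U i k) ** V m n) *: U j k.
Proof.
move=> cU cV i j m n.
have [_ [F [bF Ft FD]] _] := hh.
have [_ _ DM Dstar _] := hD.
have inv k : h (star (U i k) ** V m n) *: cone =
    \sum_l \sum_p h (star (U i l) ** V m p) *: (star (U l k) ** V p n).
  rewrite -FD DM Dstar (corep_comult cU) (corep_comult cV) star_sum cmul_suml.
  rewrite (linear_is_sum _ _ _ bF.1); apply: eq_bigr => l _.
  rewrite cmul_sumr (linear_is_sum _ _ _ bF.1); apply: eq_bigr => p _.
  by rewrite (min_tensor_star ht) (min_tensor_mul ht) Ft.
(* Multiplication by [U j k] on the left and summation over [k] leave only the terms with [l = j],
   by [corep_starr]. *)
transitivity (\sum_k U j k ** (h (star (U i k) ** V m n) *: cone)); last first.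
  by apply: eq_bigr => k _; rewrite cmulZr cmul1r.
under [RHS]eq_bigr => k _ do rewrite inv cmul_sumr.
rewrite exchange_big /= (bigD1 j)//= [X in _ = _ + X]big1 ?addr0; last first.
  move=> l lj; under eq_bigr => k _ do rewrite cmul_sumr.
  rewrite exchange_big big1//= => p _.
  under eq_bigr => k _ do rewrite cmulZr cmulA.
  by rewrite -scaler_sumr -cmul_suml (corep_starr cU) eq_sym (negPf lj) scale0r cmul0l scaler0.
under [RHS]eq_bigr => k _ do rewrite cmul_sumr.
rewrite exchange_big /=; apply: eq_bigr => p _.
under [RHS]eq_bigr => k _ do rewrite cmulZr cmulA.
by rewrite -scaler_sumr -cmul_suml (corep_starr cU) eqxx scale1r cmul1l.
Qed.

Definition mcoef : set A :=
  [set a | exists I U r (i j : I), corep t Delta U r /\ a = U i j].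

Hypothesis tot : Defs.total (Lh @` mcoef).

Lemma mcoef_ext (V : normedModType C) (f g : H -> V) : bounded_linear f -> bounded_linear g ->
  (forall I U r, @corep R A AA t Delta I U r ->
    forall i j, f (Lh (U i j)) = g (Lh (U i j))) -> f = g.
Proof.
move=> bf bg fg; apply: (total_ext tot) => // _ [_ [I [U [r [i [j [cU ->]]]]]] <-].
exact: fg cU i j.
Qed.

(* The operator (id (x) w) W for the vector functional w = <L(U_ij), . L(1)>;
   invariance of h makes it an explicit operator of finite rank. *)
Definition shift_op I (U : I -> I -> A) (i j : I) (x : H) : H :=
  \sum_k ketbra (Lh (U j k)) (Lh (U i k)) x.

Lemma shift_op_adjoint I U i j : adjoint (@shift_op I U i j) (shift_op U j i).
Proof. by apply: adjoint_sum => k; exact: adjoint_ketbra. Qed.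

Lemma shift_op_bounded I U i j : bounded_linear (@shift_op I U i j).
Proof. by apply: bounded_linear_sum => k; exact: bounded_linear_ketbra. Qed.

Lemma shift_op_Linfty I U r : corep t Delta U r ->
  forall i j : I, Linfty tH W (shift_op U i j).
Proof.
move=> cU i j.
apply: (@Linfty_slice _ _ _ _ _ (vector_functional (Lh (U i j)) (Lh cone))).
apply: (slice_right_vector htH) (shift_op_bounded U i j) _ => xi xi'.
suff : (fun v => inner xi (shift_op U i j v) : C^o) =
    (fun v => inner (tH xi (Lh (U i j))) (W (tH v (Lh cone))) : C^o).
  by move/(congr1 (@^~ xi')).
apply: mcoef_ext.
- by apply: bounded_linear_inner; exact: shift_op_bounded.
- apply: (bounded_linear_inner _ (f := fun v => W (tH v (Lh cone)))).
  apply: (bounded_linear_comp (g := fun v => tH v (Lh cone))).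
    exact: dual_kac_takesaki_bounded.
  have [_ l _ _] := htH; split; first exact: l.
  by exists `|Lh cone| => v; rewrite (htensor_norm htH) mulrC.
- move=> J V s cV m n; rewrite (dual_kac_takesaki_corep cV) inner_sumr.
  have [_ _ iT _] := htH.
  under [RHS]eq_bigr => p _ do rewrite iT cmul1r iLh mulrC -innerZr -(linear_isZ _ _ lLh).
  rewrite -inner_sumr -(linear_is_sum _ _ _ lLh) (haar_invariance cU cV).
  rewrite (linear_is_sum _ _ _ lLh); congr (inner _ _); apply: eq_bigr => k _.
  by rewrite (linear_isZ _ _ lLh) /ketbra iLh.
Qed.

Variable phi : (H -> H) -> \bar R.
Hypothesis hphi : weight tH W phi.
Variable Lphi : (H -> H) -> H.
Hypothesis hL : weight_GNS tH W phi Lphi.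
Hypothesis hpair : dual_GNS_pairing tH W phi (Lh cone) Lphi.
Local Notation N := (Nphi tH W phi).

(** Tested against [Lh c], the left side is the functional [<Lh c, . Lh (U i j)>] at [xs], which the
    pairing expresses through a slice of [W]. *)
Lemma Nphi_adjoint_coef I U r : corep t Delta U r -> forall x xs (i j : I),
  N x -> adjoint x xs ->
  xs (Lh (U i j)) = \sum_k inner (Lphi x) (Lh (U i k)) *: Lh (U k j).
Proof.
move=> cU x xs i j Nx axs.
have bxs := adjoint_bounded axs (Linfty_bounded Nx.1).
apply: (total_inner_eq tot) => _ [c _ <-].
have [srep _ _ _ piE] := hLh; have [bpi pil _ _ _] := srep.
(* The slice of [W] by that functional is [pih y], as [dual_kac_takesaki_corep] shows. *)
pose y := \sum_k h (star c ** U k j) *: U i k.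
have sl : slice_left tH (vector_functional (Lh c) (Lh (U i j))) W (pih y).
  apply: (slice_left_vector htH) (bpi _) _ => eta eta'.
  have [_ _ _ dLh _] := hLh; have [l1 _ iT _] := htH.
  move: eta'; apply: (dense_ind dLh).
    apply: (@norm_closed_eq _ _ C^o); apply: bounded_linear_lip.
      exact: (bounded_linear_inner _ (bpi y)).
    apply: (bounded_linear_inner _ (f := fun v => W (tH (Lh (U i j)) v))).
    apply: (bounded_linear_comp (g := tH (Lh (U i j)))).
      exact: dual_kac_takesaki_bounded.
    by split; [exact: l1|exists `|Lh (U i j)| => v; rewrite (htensor_norm htH)].
  move=> _ [a _ <-]; rewrite (dual_kac_takesaki_corep cU) piE inner_sumr /y.
  rewrite cmul_suml (linear_is_sum _ _ _ lLh) inner_sumr.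
  apply: eq_bigr => k _.
  by rewrite cmulZl (linear_isZ _ _ lLh) innerZr iT iLh.
have := hpair Nx axs sl.
rewrite piE cmul1r /y (linear_is_sum _ _ _ lLh) inner_sumr.
rewrite nf_eval_vector; last exact: bxs.1.
move=> <-; rewrite inner_sumr; apply: eq_bigr => k _.
by rewrite (linear_isZ _ _ lLh) !innerZr iLh mulrC.
Qed.

(* Pair x L(U_ij) with L(U_lj), weight by r_j^2 and sum over j, expanding x and
   its adjoint through the pairing. *)
Lemma tomita_coef I U r : corep t Delta U r -> forall x xs (i j : I),
  N x -> N xs -> adjoint x xs ->
  (r i) ^+ 2 * inner (Lphi xs) (Lh (U j i)) =
  (r j) ^+ 2 * (inner (Lphi x) (Lh (U i j)))^*.
Proof.
move=> cU x xs i l Nx Nxs axs.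
(* [corep_conj] under [h]: with the weights [r_j^2] the rows of [U] become orthogonal. *)
have ip k m : \sum_j (r j) ^+ 2 * inner (Lh (U k j)) (Lh (U m j)) =
    (m == k)%:R * (r m) ^+ 2.
  transitivity (h (\sum_j (r j) ^+ 2 *: (star (U k j) ** U m j))).
    rewrite (state_sum hs); apply: eq_bigr => j _.
    by rewrite (stateZ hs) iLh.
  rewrite (corep_conj cU) (stateZ hs); have [_ -> _ _] := hs.
  by rewrite mulr1.
have e1 : \sum_j (r j) ^+ 2 * inner (Lh (U i j)) (x (Lh (U l j))) =
    (r i) ^+ 2 * inner (Lphi xs) (Lh (U l i)).
  under eq_bigr => j _.
    rewrite (Nphi_adjoint_coef cU _ _ Nxs (adjoint_sym axs)) inner_sumr mulr_sumr.
    under eq_bigr => k _ do rewrite innerZr mulrCA.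
    over.
  rewrite exchange_big /=; under eq_bigr => k _ do rewrite -mulr_sumr ip.
  rewrite (bigD1 i)//= eqxx mul1r big1 ?addr0 1?mulrC// => k ki.
  by rewrite (negPf ki) mul0r mulr0.
rewrite -e1.
under eq_bigr => j _.
  rewrite -(adjoint_sym axs) (Nphi_adjoint_coef cU _ _ Nx axs) inner_suml mulr_sumr.
  under eq_bigr => k _ do rewrite innerZl mulrCA.
  over.
rewrite exchange_big /=; under eq_bigr => k _ do rewrite -mulr_sumr ip.
rewrite (bigD1 l)//= eqxx mul1r big1 ?addr0 1?mulrC// => k kl.
by rewrite eq_sym (negPf kl) mul0r mulr0.
Qed.

(* The point of the Tomita graph given by L(y^* z) and L(z^* y), where
   z = shift_op U i j \o x, zeta = L(x) and xi = L(y); it is written so that it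
   makes sense for all vectors. *)
Let graph_point I (U : I -> I -> A) (i j : I) (zeta xi : H) : H * H :=
  (\sum_k \sum_l (inner (Lh (U i k)) zeta * inner xi (Lh (U j l))) *: Lh (U l k),
   \sum_k \sum_l (inner zeta (Lh (U i k)) * inner (Lh (U j l)) xi) *: Lh (U k l)).

(** Composing [x] with [shift_op U i j] stays in the left ideal, and the finite rank lets
    [Nphi_adjoint_coef] evaluate [ys] and [xs] on coefficient vectors only. *)
Let graph_point_Nphi I U r : corep t Delta U r -> forall x y (i j : I),
  N x -> N y ->
  tomita_graph tH W phi Lphi (graph_point U i j (Lphi x) (Lphi y)).
Proof.
move=> cU x y i j Nx Ny.
have [_ [xs axs _]] := Nx; have [_ [ys ays _]] := Ny.
have [_ _ _ mL] := hL.
have MX := shift_op_Linfty cU i j.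
have Nz := Nphi_ideal hphi MX Nx.
have az := adjoint_comp axs (shift_op_adjoint U i j).
have := tomita_graph_product hphi hL Nz Ny az ays.
rewrite (mL _ _ MX Nx) /= /shift_op.
have lys := (adjoint_linear ays); have lxs := (adjoint_linear axs).
rewrite (linear_is_sum _ _ _ lys) (linear_is_sum _ _ _ lxs).
congr (tomita_graph _ _ _ _ (_, _)).
  apply: eq_bigr => k _; rewrite /ketbra (linear_isZ _ _ lys).
  rewrite (Nphi_adjoint_coef cU _ _ Ny ays) scaler_sumr.
  by apply: eq_bigr => l _; rewrite scalerA.
rewrite exchange_big; apply: eq_bigr => l _; rewrite /ketbra (linear_isZ _ _ lxs).
rewrite (Nphi_adjoint_coef cU _ _ Nx axs) scaler_sumr.
by apply: eq_bigr => k _; rewrite scalerA mulrC.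
Qed.

Let norm_closed_tomita : norm_closed (closure (tomita_graph tH W phi Lphi)).
Proof. exact: norm_closed_closure. Qed.

Let graph_point_lipl I (U : I -> I -> A) i j xi :
  lipschitzian (fun zeta => graph_point U i j zeta xi).
Proof.
apply: lipschitzian_pair; apply: lipschitzian_sum => k; apply: lipschitzian_sum => l;
  apply: lipschitzian_scalel; apply: lipschitzian_mulr.
- exact: lipschitzian_innerr.
- exact: lipschitzian_innerl.
Qed.

Let graph_point_lipr I (U : I -> I -> A) i j zeta :
  lipschitzian (fun xi => graph_point U i j zeta xi).
Proof.
apply: lipschitzian_pair; apply: lipschitzian_sum => k; apply: lipschitzian_sum => l;
  apply: lipschitzian_scalel; apply: lipschitzian_mull.
- exact: lipschitzian_innerl.
- exact: lipschitzian_innerr.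
Qed.

(** The vectors [Lphi x] are dense and the point is Lipschitz in each argument, so the two arguments
    are freed one after the other. *)
Let graph_point_closure I U r : corep t Delta U r -> forall (i j : I) zeta xi,
  closure (tomita_graph tH W phi Lphi) (graph_point U i j zeta xi).
Proof.
move=> cU i j; have [_ _ dN _] := hL.
apply: (dense_ind dN).
  apply: norm_closed_forall => xi.
  exact: norm_closed_preim (graph_point_lipl U i j xi) norm_closed_tomita.
move=> _ [x Nx <-]; apply: (dense_ind dN).
  exact: norm_closed_preim (graph_point_lipr U i j _) norm_closed_tomita.
by move=> _ [y Ny <-]; apply: subset_closure; apply: graph_point_Nphi cU _ _ _ _ Nx Ny.
Qed.

Let gram I U r : corep t Delta U r -> forall k l : I,
  \sum_i inner (Lh (U i k)) (Lh (U i l)) = (k == l)%:R.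
Proof.
move=> cU k l; under eq_bigr => i _ do rewrite iLh.
rewrite -(state_sum hs) (corep_starl cU) (stateZ hs).
by have [_ -> _ _] := hs; rewrite mulr1.
Qed.

Let sum_factor I (a b : I -> I -> C) (Z : I -> I -> H) :
  \sum_i \sum_j \sum_k \sum_l (a i k * b j l) *: Z l k =
  \sum_k \sum_l ((\sum_i a i k) * (\sum_j b j l)) *: Z l k.
Proof.
under eq_bigr => i _ do rewrite exchange_big /=.
rewrite exchange_big /=; apply: eq_bigr => k _.
under eq_bigr => i _ do rewrite exchange_big /=.
rewrite exchange_big /=; apply: eq_bigr => l _.
rewrite mulr_suml scaler_suml; apply: eq_bigr => i _.
by rewrite mulr_sumr scaler_suml.
Qed.

Let sum_delta I (k0 l0 : I) (Z : I -> I -> H) :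
  \sum_k \sum_l ((k == k0)%:R * (l0 == l)%:R : C) *: Z l k = Z l0 k0.
Proof.
rewrite (bigD1 k0)//= [X in _ + X]big1 ?addr0; last first.
  by move=> k kk; rewrite big1// => l _; rewrite (negPf kk) mul0r scale0r.
rewrite (bigD1 l0)//= big1 ?addr0; last first.
  by move=> l ll; rewrite eq_sym (negPf ll) mulr0 scale0r.
by rewrite !eqxx mulr1 scale1r.
Qed.

Variable J : H -> H.
Hypothesis hJ : modular_conjugation tH W phi Lphi J.

(* Summing the graph points with zeta = L(U_ik) and xi = L(U_jl) over i and j
   isolates a single matrix coefficient, because U is unitary. *)
Lemma tomita_closure_coef I U r : corep t Delta U r -> forall k l : I,
  closure (tomita_graph tH W phi Lphi) (Lh (U l k), Lh (U k l)).
Proof.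
move=> cU k0 l0; have [[aJ nJ sJ] [P [[dP adjP posP] clE]]] := hJ.
set S := closure _.
(* An adjoint is a linear relation, and [P] is its own adjoint; hence the closure, being the graph
   of [J P], is additive. *)
have P0 : P (0, 0) by apply/adjP => v w _; rewrite !inner0r.
have PD v w v' w' : P (v, w) -> P (v', w') -> P (v + v', w + w').
  by move=> /adjP p /adjP p'; apply/adjP => a b Pab; rewrite !innerDr (p _ _ Pab) (p' _ _ Pab).
have S0 : S 0 by rewrite /S clE; exists 0; rewrite (antilinear0 aJ).
have SD p p' : S p -> S p' -> S (p + p').
  rewrite /S clE => -[w [Pw e]] [w' [Pw' e']]; exists (w + w'); split; first exact: PD.
  by rewrite (antilinearD _ _ aJ) -e -e'.
have sumS (F : I -> H * H) : (forall i, S (F i)) -> S (\sum_i F i).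
  by move=> SF; elim/big_ind : _.
have fst_sum (F : I -> H * H) : (\sum_i F i).1 = \sum_i (F i).1.
  exact: (big_morph (fun p : H * H => p.1)).
have snd_sum (F : I -> H * H) : (\sum_i F i).2 = \sum_i (F i).2.
  exact: (big_morph (fun p : H * H => p.2)).
have -> : (Lh (U l0 k0), Lh (U k0 l0)) =
    \sum_i \sum_j graph_point U i j (Lh (U i k0)) (Lh (U j l0)).
  rewrite [RHS]surjective_pairing fst_sum snd_sum.
  congr pair.
    under eq_bigr => i _ do rewrite fst_sum.
    rewrite (sum_factor (fun i k => inner (Lh (U i k)) (Lh (U i k0)))
      (fun j l => inner (Lh (U j l0)) (Lh (U j l))) (fun l k => Lh (U l k))).
    under eq_bigr => k _ do under eq_bigr => l _ do rewrite !(gram cU).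
    by rewrite (sum_delta k0 l0 (fun l k => Lh (U l k))).
  under eq_bigr => i _ do rewrite snd_sum.
  rewrite (sum_factor (fun i k => inner (Lh (U i k0)) (Lh (U i k)))
    (fun j l => inner (Lh (U j l)) (Lh (U j l0))) (fun l k => Lh (U k l))).
  under eq_bigr => k _ do under eq_bigr => l _ do
    rewrite !(gram cU) (eq_sym k0) (eq_sym l).
  by rewrite (sum_delta k0 l0 (fun l k => Lh (U k l))).
by apply: (sumS) => i; apply: (sumS) => j; exact: graph_point_closure cU _ _ _ _.
Qed.

(* For the Tomita operator J P and v = L(U_ij), both P v = w and
   P w = k^2 v hold with k = r_j / r_i; positivity of P then forces w = k v. *)
Lemma modular_conjugation_coef I U r : corep t Delta U r -> forall i j : I,
  J (Lh (U i j)) = (r i / r j) *: Lh (U j i).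
Proof.
move=> cU i j; have [[aJ nJ sJ] [P [[dP adjP posP] clE]]] := hJ.
have ri0 := corep_pos cU i; have rj0 := corep_pos cU j.
have PL c v w v' w' : P (v, w) -> P (v', w') -> P (c *: v + v', c *: w + w').
  move=> /adjP p /adjP p'; apply/adjP => a b Pab.
  by rewrite !innerDr !innerZr (p _ _ Pab) (p' _ _ Pab).
have := @tomita_closure_coef I U r cU j i; rewrite clE => -[w [/= Pvw vE]].
set v := Lh (U i j) in Pvw *; set v' := Lh (U j i) in vE *.
(* The relation of [tomita_coef] is a closed condition on graph points, so it holds on the
   closure. *)
have coef x y : closure (tomita_graph tH W phi Lphi) (x, y) ->
    (r i) ^+ 2 * inner y v' = (r j) ^+ 2 * (inner x v)^*.
  pose Q (p : H * H) := (r i) ^+ 2 * inner p.2 v' = (r j) ^+ 2 * inner v p.1.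
  suff Qc : norm_closed Q.
    move=> /closure_approx cxy; rewrite -inner_conj.
    apply: (Qc (x, y)) => e e0; have [p [a [as_ [Na Nas aas ->]]] pe] := cxy e e0.
    exists (Lphi a, Lphi as_) => //; rewrite /Q /= (inner_conj _ v).
    exact: tomita_coef cU _ _ _ _ Na Nas aas.
  have lfst : lipschitzian (fun p : H * H => p.1).
    by exists 1 => // p p'; rewrite mul1r prod_normE /= /Num.max; case: ifP => // /ltW.
  have lsnd : lipschitzian (fun p : H * H => p.2).
    exists 1 => // p p'; rewrite mul1r prod_normE /= /Num.max; case: ifP => //.
    by rewrite real_ltNge ?ger0_real// => /negbFE.
  apply: (@norm_closed_eq _ _ C^o).
    apply: lipschitzian_mull; exact: lipschitzian_comp (lipschitzian_innerl v') lsnd.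
  apply: lipschitzian_mull; exact: lipschitzian_comp (lipschitzian_innerr v) lfst.
pose k := r j / r i.
have k0 : 0 < k by rewrite divr_gt0.
have rr (m : I) : (r m ^+ 2)^* = r m ^+ 2.
  by rewrite geC0_conj// exprn_ge0// ltW// (corep_pos cU).
(* Membership in [P] is tested as membership in its adjoint, by [coef] at the point [(a, J b)] for
   each [(a, b)] in [P]. *)
have Pw : P (w, k ^+ 2 *: v).
  apply/adjP => a b Pab.
  have := coef a (J b); rewrite clE => /(_ (ex_intro _ b (conj Pab erefl))).
  rewrite vE (antilinear_isometry_inner aJ nJ) => /(congr1 Num.conj).
  rewrite [LHS]rmorphM [RHS]rmorphM /= !rr !conjCK innerZr => e.
  apply: (mulfI (x := (r i) ^+ 2)); first by rewrite expf_neq0// gt_eqF.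
  by rewrite e mulrA -exprMn /k mulrCA divff ?mulr1// gt_eqF.
have Pd := PL (- k) _ _ _ _ Pvw Pw.
have wkv : w = k *: v.
  have := posP _ _ Pd.
  have -> : - k *: w + k ^+ 2 *: v = (- k) *: (- k *: v + w).
    by rewrite scalerDr scalerA mulrNN addrC.
  rewrite innerZr inner_norm mulNr oppr_ge0 pmulr_rle0//.
  move=> le0; have /eqP : `|- k *: v + w| ^+ 2 = 0.
    by apply/le_anti; rewrite le0 exprn_ge0.
  by rewrite sqrf_eq0 normr_eq0 scaleNr addrC subr_eq0 => /eqP.
rewrite vE wkv (antilinearZ _ _ aJ) geC0_conj ?(ltW k0)// scalerA.
by rewrite /k mulrA divfK ?gt_eqF// divff ?gt_eqF// scale1r.
Qed.

End DualWeight.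

(** * The conjugation in the representations [psi] *)

Section Psi.
Variables (R : realType) (q : R) (L : hilbertType R) (e : nat -> L).
Local Notation C := R[i].
Hypotheses (hq0 : q != 0) (he : orthonormal_basis e).
Variables (A : cstarType R) (al ga : A) (psi : R[i] -> A -> L -> L).
Hypothesis hpsi : psi2_rep q e al ga psi.
Variable j : L -> L.
Hypothesis hj : basis_conjugation e j.

Let aj : antilinear j. Proof. by case: hj. Qed.
Let je k : j (e k) = e k. Proof. by case: hj. Qed.
Let te : Defs.total (range e). Proof. by case: he. Qed.
Let jK := basis_conjugationK he hj.
Let jn := basis_conjugation_norm he hj.

(* On coefficients of corepresentations, b is R(a)^* for the unitary antipode R. *)
Definition conj_related (a b : A) : Prop :=
  forall l, torus l -> psi l b = conj_field j q (psi^~ a) l.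

(** Between the two factors [j \o j] cancels, so the order of the product is kept. *)
Lemma conj_related_mul a b a' b' :
  conj_related a b -> conj_related a' b' -> conj_related (a ** a') (b ** b').
Proof.
move=> ab ab' l tl; have [[_ _ _ M _] _ _] := hpsi tl.
have [[_ _ _ M' _] _ _] := hpsi (torus_flip hq0 tl).
rewrite M (ab l tl) (ab' l tl) /conj_field; apply/funext => v /=.
by rewrite M' /= jK.
Qed.

Lemma conj_related_lincomb c a b a' b' : conj_related a b -> conj_related a' b' ->
  conj_related (c *: a + a') (c^* *: b + b').
Proof.
move=> ab ab' l tl; have [[_ D _ _ _] _ _] := hpsi tl.
have [[_ D' _ _ _] _ _] := hpsi (torus_flip hq0 tl).
apply/funext => v; rewrite D (ab l tl) (ab' l tl) /conj_field /=.
by rewrite D' aj.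
Qed.

Lemma conj_related0 : conj_related 0 0.
Proof.
have z l : torus l -> psi l 0 = fun=> 0.
  move=> tl; have [[_ D _ _ _] _ _] := hpsi tl; apply/funext => v.
  by have := D (-1) 0 0 v; rewrite scaler0 addr0 scaleN1r addNr.
move=> l tl; rewrite /conj_field (z _ tl) (z _ (torus_flip hq0 tl)).
by apply/funext => v /=; rewrite (antilinear0 aj).
Qed.

Lemma conj_relatedZ c a b : conj_related a b -> conj_related (c *: a) (c^* *: b).
Proof. by move=> ab; have := conj_related_lincomb c ab conj_related0; rewrite !addr0. Qed.

Lemma conj_related_star a b : conj_related a b -> conj_related (star a) (star b).
Proof.
move=> ab l tl; have [[_ _ _ _ S] _ _] := hpsi tl.
have [[_ _ _ _ S'] _ _] := hpsi (torus_flip hq0 tl).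
apply: (adjoint_uniq (S b)); rewrite (ab l tl) => x y.
rewrite /conj_field /= -(jK y) (basis_conjugation_inner he hj) S'.
by rewrite -(basis_conjugation_inner he hj) !jK.
Qed.

Let bounded_ext (f g : L -> L) : bounded_linear f -> bounded_linear g ->
  (forall k, f (e k) = g (e k)) -> f = g.
Proof. by move=> bf bg fg; apply: (total_ext te bf bg) => _ [k _ <-]. Qed.

Lemma conj_related_al : conj_related al al.
Proof.
move=> l tl; have [[B _ _ _ _] E _] := hpsi tl.
have [[B' _ _ _ _] E' _] := hpsi (torus_flip hq0 tl).
apply: bounded_ext => //; first exact: antilinear_conj_bounded.
move=> k; rewrite /conj_field /= je E E' (antilinearZ _ _ aj) conjC_realc.
by case: k => [|k]; rewrite ?(antilinear0 aj) ?je.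
Qed.

(** Both sides are diagonal: conjugation by [j] replaces the eigenvalue [- sgn(q) l q^k] by its
    complex conjugate, which is that of [- sgn(q)] times [star ga] at [l]. *)
Lemma conj_related_ga : conj_related ga ((- (Num.sg q)%:C) *: star ga).
Proof.
move=> l tl; have [[B D _ _ S] _ E] := hpsi tl.
have [[B' _ _ _ _] _ E'] := hpsi (torus_flip hq0 tl).
have [ee _] := he.
apply: bounded_ext => //; first exact: antilinear_conj_bounded.
move=> k; rewrite /conj_field /= je E' (antilinearZ _ _ aj) je.
have := D (- (Num.sg q)%:C) (star ga) 0 (e k); rewrite addr0 => ->.
have -> : psi l 0 (e k) = 0.
  by have := D (-1) 0 0 (e k); rewrite scaler0 addr0 scaleN1r addNr.
rewrite addr0.
have -> : psi l (star ga) (e k) = (l^* * (q ^+ k)%:C) *: e k.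
  apply: (total_inner_eq te) => _ [m _ <-].
  rewrite -S E innerZl innerZr ee rmorphM /= conjC_realc.
  by case: eqVneq => [->|_]; rewrite ?mulr0.
by rewrite scalerA rmorphM rmorphN rmorphM /= !conjC_realc mulNr !mulrA -mulNr.
Qed.

(** Off the diagonal, the ratio of weights matches the sign through [|q|^-1 q = sgn(q)] and
    [sgn(q) q = |q|]. *)
Lemma conj_related_fund i k : conj_related (fund q al ga i k)
  ((fund_weight q i / fund_weight q k) *: fund q al ga k i).
Proof.
have sgn : (`|q|^-1)%:C * q%:C = (Num.sg q)%:C.
  by rewrite -rmorphM /= {2}[q]numEsg mulrCA mulVf ?mulr1// normr_eq0.
have sgn2 : (Num.sg q)%:C * q%:C = (`|q|)%:C by rewrite -rmorphM /= normrEsg.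
have q0 : (`|q|^-1)%:C != 0 :> C.
  by rewrite -(rmorph0 (real_complex R)) (inj_eq (@complexI _)) invr_eq0 normr_eq0.
have := conj_related_star conj_related_al; have := conj_related_al.
have gg := conj_related_ga.
have gs := conj_related_star gg.
rewrite /fund_weight; case: i; case: k => /= h1 h2.
- by rewrite divff// scale1r.
- rewrite divr1 scalerN scalerA sgn -scaleNr; exact: gg.
- have := conj_relatedZ (- q%:C) gs; rewrite starZ starK scalerA scaleNr.
  rewrite !rmorphN /= !conjC_realc mulrNN mulrC sgn2 div1r -fmorphV invrK.
  exact.
- by rewrite divr1 scale1r.
Qed.

(** The scalar is the one in [modular_conjugation_coef], so [J] and the fibrewise conjugation can be
    compared on these coefficients; it is multiplicative along the word. *)
Lemma conj_related_word n (i k : word n) : conj_related (word_corep q al ga i k)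
  ((word_weight q i / word_weight q k) *: word_corep q al ga k i).
Proof.
elim: n i k => [[] []|n ih [i i'] [k k']] /=.
  move=> l tl; have [[_ _ I _ _] _ _] := hpsi tl.
  have [[_ _ I' _ _] _ _] := hpsi (torus_flip hq0 tl).
  rewrite divr1 scale1r I /conj_field I'; apply/funext => v /=; exact/esym/jK.
rewrite /tensor_corep /= -mulf_div -scalerA -cmulZr -cmulZl.
exact: conj_related_mul (conj_related_fund i k) (ih i' k').
Qed.

End Psi.

(** * Extension from matrix coefficients to the whole direct integral *)

Theorem proposition7p4 (R : realType) (q : R)
  (hq : -1 < q < 1) (hq0 : q != 0)
  (* C(SU_q(2)), its comultiplication and its Haar state *)
  (A : cstarType R) (al ga : A) (hA : is_CSUq2 q al ga)
  (AA : cstarType R) (tA : A -> A -> AA) (hAA : min_tensor tA)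
  (Delta : A -> AA) (hDelta : is_SUq2_comultiplication q al ga tA Delta)
  (h : A -> R[i]) (hh : haar_state tA Delta h)
  (* L^2(G), the GNS map of h, and the Kac-Takesaki operators of G and Gamma *)
  (H : hilbertType R) (pih : A -> H -> H) (Lh : A -> H) (hLh : GNS h pih Lh)
  (HH : hilbertType R) (tH : H -> H -> HH) (htH : hilbert_tensor tH)
  (WG WGamma : HH -> HH) (hWG : kac_takesaki tA Delta tH Lh WG)
  (hWGamma : dual_kac_takesaki tH WG WGamma)
  (* the left Haar integral of Gamma, its GNS map and modular conjugation *)
  (phi : (H -> H) -> \bar R) (hphi : left_haar_integral tH WGamma phi)
  (Lphi : (H -> H) -> H) (hLphi : weight_GNS tH WGamma phi Lphi)
  (hpair : dual_GNS_pairing tH WGamma phi (Lh cone) Lphi)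
  (J : H -> H) (hJ : modular_conjugation tH WGamma phi Lphi J)
  (* l^2(Z_+), the representations psi^{2,lambda}, the direct integral, Q_L *)
  (L : hilbertType R) (e : nat -> L) (he : orthonormal_basis e)
  (psi : R[i] -> A -> L -> L) (hpsi : psi2_rep q e al ga psi)
  (Dinv : L -> L) (hDinv : Plancherel_Dinv q e Dinv)
  (K : hilbertType R) (dint : (R[i] -> L -> L) -> K)
  (hK : direct_integral e dint)
  (QL : H -> K) (QLs : K -> H) (hQL : Plancherel_QL e dint Lh psi Dinv QL QLs)
  (j : L -> L) (hj : basis_conjugation e j) :
  forall (T : R[i] -> L -> L) (k : K), represents e dint T k ->
    represents e dint
      (fun l => j \o T (- ((Num.sg q)%:C * l)) \o j) (QL (J (QLs k))).
Proof.
have [hrel gen _] := hA; have hD : star_hom Delta by case: hDelta.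
have [hs _ _] := hh; have [_ lLh _ dLh _] := hLh.
have cU n := word_corepP hAA hD hq0 hrel hDelta n.
have bLh := GNS_bounded hs hLh.
pose E := [set a : A | exists n i k, a = @word_corep R A q al ga n i k].
have totA : Defs.total E := word_coef_total hq0 gen.
have totE : Defs.total (Lh @` E) := total_image totA bLh dLh.
have sub : E `<=` mcoef tA Delta.
  move=> a [n [i [k ->]]].
  by exists (word n), (@word_corep R A q al ga n), (@word_weight R q n), i, k.
have tot : Defs.total (Lh @` mcoef tA Delta).
  by apply: total_subset totE => _ [a Ea <-]; exists a => //; exact: sub.
have [hw _ _ _ _] := hphi.
have JE n i k := modular_conjugation_coef hAA hD hh hLh htH hWG hWGamma tot hw hLphi hpair
  hJ (@cU n) i k.
have [[aJ nJ _] _] := hJ; have [uQ rQ] := hQL.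
have [dlin dn dsurj] := hK; have [aj _ je] := hj; have [bD De] := hDinv.
have te : Defs.total (range e) by case: he.
(* [Dinv] is diagonal with real eigenvalues in the basis fixed by [j]. *)
have jD : j \o Dinv = Dinv \o j.
  have : j \o Dinv \o j = Dinv.
    apply: (total_ext te) => //.
      exact: antilinear_conj_bounded aj (basis_conjugation_norm he hj) bD.
    by move=> _ [m _ <-]; rewrite /= je De (antilinearZ _ _ aj) je conjC_realc.
  move=> {2}<-; apply/funext => v /=.
  by rewrite (basis_conjugationK he hj).
pose F a : R[i] -> L -> L := fun l => psi l a \o Dinv.
have F2 a : L2_field e (F a) by have [] := rQ a.
have FE a : QL (Lh a) = dint (F a) by have [] := rQ a.
have Flin c a b l : torus l -> F (c *: a + b) l = (fun v => c *: F a l v + F b l v).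
  by move=> tl; have [[_ D _ _ _] _ _] := hpsi l tl; apply/funext => v; rewrite /F /= D.
have cF2 a := L2_conj_field he hj hq0 (F2 a).
(* The asserted formula at the vector [Lh a]; both sides are antilinear in [a]. *)
pose good a := QL (J (Lh a)) = dint (conj_field j q (F a)).
have lQ : linear QL by case: uQ => -[].
have good_lincomb c a b : good a -> good b -> good (c *: a + b).
  rewrite /good lLh aJ lQ => -> ->; rewrite -dlin//.
  apply: (eq_dint he hK); [exact: L2_field_lincomb|exact: cF2|] => l tl.
  rewrite [RHS]/conj_field Flin; last exact: torus_flip.
  by apply/funext => v /=; rewrite aj.
have good_E a : E a -> good a.
  move=> [n [i [m ->]]]; rewrite /good JE -(linear_isZ _ _ lLh) FE.
  apply: (eq_dint he hK) => // l tl.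
  rewrite /F (conj_related_word hq0 he hpsi hj i m tl) /conj_field.
  apply/funext => v /=.
  by rewrite -[j (Dinv v)]/((j \o Dinv) v) jD.
have good_span a : lspan E a -> good a.
  elim=> [|c x v Ex _ gv]; last by apply: good_lincomb => //; exact: good_E.
  (* The formula at [0] is obtained from [0 = - cone + cone]. *)
  have g1 : good cone by apply: good_E; exists 0%N, tt, tt.
  by have := good_lincomb (-1) _ _ g1 g1; rewrite scaleN1r addNr.
move=> T k [T2 kT]; split; first exact: (L2_conj_field he hj hq0 T2).
apply/eqP; rewrite -subr_eq0; apply/eqP; apply: eq0_of_small => eps e0.
have [_ _ _ QsK] := uQ.
have e2 : 0 < eps / 2 by rewrite divr_gt0.
(* Replacing [QLs k] by a nearby [Lh a] with [a] in the span moves each side of the formula by less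
   than [eps / 2], since both sides are isometric. *)
have [_ /= [a sa ->] ka] : exists2 x, (exists2 a, lspan E a & x = Lh a) & `|QLs k - x| < eps / 2.
  have /closure_approx/(_ _ e2)[x sx xk] := @total_closure_lspan _ _ _ totE (QLs k).
  exists x => //; elim: sx => [|c _ v [b Eb <-] _ [a sa ->]].
    by exists 0; [exact: lspan_nil|rewrite (linear_is0 lLh)].
  by exists (c *: b + a); [exact: lspan_cons|rewrite lLh].
have ga' := good_span a sa.
rewrite -(subrKA (QL (J (Lh a)))) ga' (splitr eps).
apply: le_lt_trans (ler_normD _ _) _; rewrite -{1}ga' ltrD//.
  rewrite -(linear_isB _ _ lQ) -(antilinearB _ _ aJ) (unitary_norm uQ) nJ.
  exact: ka.
rewrite -rnormE (conj_field_dist he hK hj hq0 (F2 a) T2) rnormE -FE -kT.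
by rewrite -{1}(QsK k) -(linear_isB _ _ lQ) (unitary_norm uQ) distrC.
Qed.
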